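(* For any $k$, among trees of order $n$ with $m$ segments, the Steiner $k$-Wiener index is maximized by one of the caterpillars $T_i$, $T_{ii}$, $T_{iii}$, $T_{iv}$. Here each of the four trees is a caterpillar of order $n$ with $m$ segments, with internal vertices $v_1,\ldots,v_{t-1}$ on a path $P(v_0,v_t)=v_0v_1\cdots v_{t-1}v_t$ (all vertices off this path being leaves adjacent to vertices among $v_1,\dots,v_{t-1}$), and, with $d(v)$ denoting the degree of $v$: - $T_i$ ($t=\frac{2n-m-3}{2}$): $d(v_1)=d(v_{t-1})=4$, $d(v_2)=d(v_3)=\cdots=d(v_{\lfloor\frac{m-7}{4}\rfloor+1})=3$, $d(v_{t-2})=d(v_{t-3})=\cdots=d(v_{t-\lceil\frac{m-7}{4}\rceil-1})=3$, and all other internal vertices have degree $2$. - $T_{ii}$ ($t=\frac{2n-m-1}{2}$): $d(v_1)=d(v_2)=\cdots=d(v_{\lfloor\frac{m-1}{4}\rfloor})=3$, $d(v_{t-1})=d(v_{t-2})=\cdots=d(v_{t-\lceil\frac{m-1}{4}\rceil})=3$, and all other internal vertices have degree $2$. - $T_{iii}$ ($t=\frac{2n-m-2}{2}$, $m\equiv 0 \bmod 4$): $d(v_1)=4$, $d(v_2)=d(v_3)=\cdots=d(v_{\frac{m}{4}-1})=3$, $d(v_{t-1})=d(v_{t-2})=\cdots=d(v_{t-\frac{m}{4}})=3$, and all other internal vertices have degree $2$. - $T_{iv}$ ($t=\frac{2n-m-2}{2}$, $m\equiv 2 \bmod 4$): $d(v_1)=4$, $d(v_2)=d(v_3)=\cdots=d(v_{\lfloor\frac{m-4}{4}\rfloor+1})=3$,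 $d(v_{t-1})=d(v_{t-2})=\cdots=d(v_{t-\lceil\frac{m-4}{4}\rceil})=3$, and all other internal vertices have degree $2$.
   Context: All graphs are finite and simple. For a connected graph $G$ and $S\subseteq V(G)$, the Steiner distance $d(S)$ is the minimum size (number of edges) of a connected subgraph of $G$ whose vertex set contains $S$. The Steiner $k$-Wiener index is $SW_k(G)=\sum_{S\subseteq V(G),\,|S|=k} d(S)$, where $k$ is a positive integer. A branch vertex of a tree is a vertex of degree at least 3. A segment of a tree $T$ is a subpath $P$ of $T$ such that all internal vertices of $P$ have degree 2 in $T$ and each end of $P$ is either a leaf or a branch vertex of $T$. A caterpillar is a tree in which the removal of all leaves leaves a path. ''Maximized by one of'' means that one of the listed trees attains the maximum. Each of the four trees is considered only for those $n,m$ for which a tree of order $n$ with $m$ segments fitting its description exists (in particular $T_i$ and $T_{ii}$ require $m$ odd). An index range such as $v_2,\ldots,v_r$ with $r<2$ is empty (and similarly for the other ranges).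
   Formalization: The cases m = 4 and n = 1 are excluded: trees with these parameters exist (for example the star of order 5 with 4 segments, and the one-vertex tree), but no tree fits any of the descriptions T_i, T_ii, T_iii, T_iv, so the claim fails there. *)

(* Defs.v *)
From mathcomp Require Import all_boot.

Set Implicit Arguments.
Unset Strict Implicit.
Unset Printing Implicit Defensive.

Record sgraph := SGraph {
  vertex :> finType;
  edge : rel vertex;
  edge_sym : symmetric edge;
  edge_irrefl : irreflexive edge
}.

Section Graph.
Variable G : sgraph.
Implicit Types (x y : G) (S : {set G}).

Definition edge_set : {set {set G}} :=
  [set F : {set G} | [exists x, exists y, edge x y && (F == [set x; y])]].

Definition connected_graph : Prop := 0 < #|G| /\ forall x y, connect (@edge G) x y.

Definition acyclic : Prop := forall c : seq G, ucycle (@edge G) c -> size c <= 2.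

Definition is_tree : Prop := connected_graph /\ acyclic.

Definition degree x : nat := #|[set y | edge x y]|.
Definition leaf x : bool := degree x == 1.
Definition branch x : bool := 3 <= degree x.

(* A candidate subgraph is a pair (vertex set, edge set). *)
Definition pregraph : finType := ({set G} * {set {set G}})%type.
Implicit Type H : pregraph.

Definition subgraph H : bool :=
  (H.2 \subset edge_set) && [forall F in H.2, F \subset H.1].

Definition connected_sub H : bool :=
  (H.1 != set0) &&
  [forall x in H.1, forall y in H.1, connect [rel a b | [set a; b] \in H.2] x y].

Definition steiner_sub S H : bool :=
  [&& subgraph H, connected_sub H & S \subset H.1].

Definition whole : pregraph := (setT, edge_set).

(* Meaningful for connected G only, where the default [whole] is itself a
   candidate: see steiner_dist_witness and steiner_dist_min. *)
Definition steiner_dist S : nat :=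
  #|([arg min_(H < whole | steiner_sub S H) #|H.2|]).2|.

Definition SW (k : nat) : nat := \sum_(S : {set G} | #|S| == k) steiner_dist S.

(* The vertex sequence s traverses a segment. A segment has at least one edge,
   so a lone branch vertex is not one. *)
Definition segment_seq (s : seq G) : bool :=
  if s is x :: p then
    [&& p != [::], path (@edge G) x p, uniq s,
        all (fun y => degree y == 2) (behead (belast x p)),
        leaf x || branch x & leaf (last x p) || branch (last x p)]
  else false.

Definition path_graph (s : seq G) : pregraph :=
  ([set x in s], [set [set ab.1; ab.2] | ab in zip s (behead s)]).

(* Segments are counted as subgraphs, so that the two traversals of a segment
   are identified. Traversals have no repeated vertex, hence the bound #|G|. *)
Definition segments : {set pregraph} :=
  [set path_graph s | s : {bseq #|G| of G} & segment_seq s].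

Definition tree_with (n m : nat) : Prop :=
  [/\ is_tree, #|G| = n & #|segments| = m].

(* A tree has no chords, so the non-leaf vertices induce a path as soon as
   they can be enumerated along one. The empty path is allowed (K_2). *)
Definition caterpillar : Prop :=
  is_tree /\
  exists s : seq G, [/\ uniq s, sorted (@edge G) s & forall x, (x \in s) = ~~ leaf x].

(* v 0, ..., v t is a path whose inner vertices are exactly the non-leaves of G
   (so v 0 and v t are leaves); values v j with t < j are irrelevant. *)
Definition spine (t : nat) (v : nat -> G) : Prop :=
  [/\ 0 < t,
      {in [pred j | j <= t] &, injective v},
      forall j, j < t -> edge (v j) (v j.+1),
      forall x, ~~ leaf x <-> exists2 j, 0 < j < t & x = v j
    & forall x, (forall j, j <= t -> x <> v j) ->
        leaf x /\ exists2 j, 0 < j < t & edge x (v j)].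

(* D4 and D3 are the index sets where degrees 4 and 3 are prescribed; the
   prescriptions are all imposed, so incompatible ones have no solution. *)
Definition spine_degrees (t : nat) (v : nat -> G) (D4 D3 : pred nat) : Prop :=
  [/\ forall j, D4 j -> degree (v j) = 4,
      forall j, D3 j -> degree (v j) = 3
    & forall j, 0 < j < t -> ~~ D4 j -> ~~ D3 j -> degree (v j) = 2].

Definition caterpillar_shape (n m t : nat) (D4 D3 : pred nat) : Prop :=
  [/\ caterpillar, tree_with n m
    & exists2 v : nat -> G, spine t v & spine_degrees t v D4 D3].

End Graph.

Definition ceil_div (a b : nat) : nat := (a + b.-1) %/ b.

(* In the four shapes below, t = (2n - m - c) / 2 is written 2t + m + c = 2n, and
   an index condition t - a <= j is written t <= j + a. When m - 7, m - 4 or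
   m - 1 would be negative, truncating it to 0 still gives empty index ranges,
   as the signed floor and ceiling do. *)

Definition T_i (n m : nat) (G : sgraph) : Prop :=
  exists2 t, 2 * t + m + 3 = 2 * n &
  caterpillar_shape G n m t
    (fun j => (j == 1) || (j == t.-1))
    (fun j => (2 <= j <= (m - 7) %/ 4 + 1)
           || (t <= j + ceil_div (m - 7) 4 + 1) && (j + 2 <= t)).

Definition T_ii (n m : nat) (G : sgraph) : Prop :=
  exists2 t, 2 * t + m + 1 = 2 * n &
  caterpillar_shape G n m t
    (fun j => false)
    (fun j => (1 <= j <= (m - 1) %/ 4)
           || (t <= j + ceil_div (m - 1) 4) && (j + 1 <= t)).

Definition T_iii (n m : nat) (G : sgraph) : Prop :=
  4 %| m /\
  exists2 t, 2 * t + m + 2 = 2 * n &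
  caterpillar_shape G n m t
    (fun j => j == 1)
    (fun j => (2 <= j <= m %/ 4 - 1)
           || (t <= j + m %/ 4) && (j + 1 <= t)).

Definition T_iv (n m : nat) (G : sgraph) : Prop :=
  m = 2 %[mod 4] /\
  exists2 t, 2 * t + m + 2 = 2 * n &
  caterpillar_shape G n m t
    (fun j => j == 1)
    (fun j => (2 <= j <= (m - 4) %/ 4 + 1)
           || (t <= j + ceil_div (m - 4) 4) && (j + 1 <= t)).

Section SteinerFacts.
Variable G : sgraph.
Hypothesis Gconn : connected_graph G.
Implicit Types (S : {set G}) (H : pregraph G).

Lemma whole_steiner S : steiner_sub S (whole G).
Proof.
case: Gconn => /card_gt0P[x0 _] conG; apply/and3P; split.
- by rewrite /subgraph subxx /=; apply/forall_inP => F _; apply: subsetT.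
- apply/andP; split; first by apply/set0Pn; exists x0.
  apply/forall_inP => x _; apply/forall_inP => y _ /=.
  apply: connect_sub (conG x y) => a b eab; apply: connect1 => /=.
  by rewrite inE; apply/existsP; exists a; apply/existsP; exists b; rewrite eab eqxx.
- exact: subsetT.
Qed.

Lemma steiner_dist_witness S : exists2 H, steiner_sub S H & steiner_dist S = #|H.2|.
Proof.
rewrite /steiner_dist; case: arg_minnP => [|H SH _]; first exact: whole_steiner.
by exists H.
Qed.

Lemma steiner_dist_min S H : steiner_sub S H -> steiner_dist S <= #|H.2|.
Proof.
rewrite /steiner_dist; case: arg_minnP => [|H0 _ minH]; first exact: whole_steiner.
exact: minH.
Qed.

End SteinerFacts.

(* Main.v *)
Require Import Defs.
From mathcomp Require Import all_boot.
From mathcomp Require Import zify.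

Set Implicit Arguments.
Unset Strict Implicit.
Unset Printing Implicit Defensive.

(** Deleting an edge e of a tree on n vertices leaves parts of a and n - a
vertices, and e lies on the Steiner tree of S exactly when S meets both parts.
Hence SW_k is the sum over the edges of F(a), with
F(a) = C(n,k) - C(a,k) - C(n-a,k) ([SW_rooted]). Only three properties of F
matter: it is symmetric about n/2, nondecreasing up to n/2, and concave.
Moreover, orienting the tree towards a leaf r, every segment is determined by its
lower end, which can be any vertex other than r of degree different from 2; so a
tree has m segments exactly when it has n - 1 - m vertices of degree 2
([segments_degree2]). The task is thus to maximize the sum of F over the edges
when n and the number z of vertices of degree 2 are given.

Straightening ([reattach], [straighten]). Fix a path between two leaves. If a
neighbour x of the path has further branches, of b vertices in total, move them
from x to the end of the path that has fewer vertices on its side. The degrees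
are only permuted. The edge at x goes from F(1 + b) to F(1), the pendant edge at
the end of the path from F(1) to F(1 + b), and each other path edge between the
two places from F(a) to F(a + b), where 2a + b <= n by the choice of the end:
nothing is lost. Since the path gets longer, this ends with a caterpillar.

Words. A caterpillar is the word of the numbers d(v_i) - 1 along its spine. The
word has sum n - 2 and z letters 1, and the spine edges have the partial sums of
the word, plus 1, on their left. So the sum of F over the edges is a constant
minus the sum of G(y) = F(y + 1) - F(1) over the positions y strictly inside a
letter: the skipped positions ([word_sum_cost]). Letters of at least 2 have a
total of M = n - 2 - z = m - 1, and one wants them to skip cheap positions, that
is positions close to the two ends.

Lower bound. Cut the word in the middle. If long letters use up mu on one half,
the positions they skip there cost at least L(mu) ([half_min_cost]), where
L(0) = 0, L(1) = G(1), L(mu + 2) = G(mu + 1) + L(mu): this is the cost of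
letters 2 packed against the end, after one letter 3 if mu is odd. It remains to
minimize L(mu) + L(nu) for mu + nu = M. Within a parity class the balanced choice
is best since G is nondecreasing, and two odd shares are no better than two even
ones since G is concave ([half_min_balanced]). The resulting word is that of T_ii
for odd m, and of T_iii or T_iv for even m ([split_word_optimal]). *)

(** * Words of steps and the cost of their skipped positions *)

(** The sum of [g] over the positions strictly inside the steps, when the word
[w] is walked from [a]. *)
Fixpoint cost (g : nat -> nat) (a : nat) (w : seq nat) : nat :=
  if w is x :: w' then \sum_(a.+1 <= i < a + x) g i + cost g (a + x) w' else 0.

Definition long_sum (w : seq nat) : nat := sumn [seq x <- w | 1 < x].

Lemma cost_cat g a w1 w2 :
  cost g a (w1 ++ w2) = cost g a w1 + cost g (a + sumn w1) w2.
Proof.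
by elim: w1 a => [|x w1 IH] a /=; rewrite ?addn0 // IH !addnA.
Qed.

Lemma eq_cost g g' a w :
    (forall i, a < i < a + sumn w -> g i = g' i) -> cost g a w = cost g' a w.
Proof.
elim: w a => [|x w IH] a //= gg'; congr (_ + _).
  by apply: eq_big_nat => i hi; apply: gg'; lia.
by apply: IH => i hi; apply: gg'; lia.
Qed.

(** Reading a word backwards mirrors its skipped positions; this brings the right
half of a word back to the left. *)
Lemma cost_rev g N a w :
  a + sumn w = N -> cost (fun i => g (N - i)) a w = cost g 0 (rev w).
Proof.
elim: w a => [|x w IH] a //= aN.
rewrite rev_cons -cats1 cost_cat /= addn0 sumn_rev add0n addnC IH; last by lia.
congr (_ + _); rewrite big_nat_rev /= -{1}[a.+1]add0n big_addn.
rewrite -{1}[(sumn w).+1]add0n big_addn.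
have -> : a + x - a.+1 = sumn w + x - (sumn w).+1 by lia.
by apply: eq_big_nat => i hi; congr g; lia.
Qed.

Lemma long_sum_cat w1 w2 : long_sum (w1 ++ w2) = long_sum w1 + long_sum w2.
Proof. by rewrite /long_sum filter_cat sumn_cat. Qed.

Lemma long_sum_rev w : long_sum (rev w) = long_sum w.
Proof. by rewrite /long_sum filter_rev sumn_rev. Qed.

Lemma long_sum_count1 w :
  all (leq 1) w -> long_sum w + count_mem 1 w = sumn w.
Proof.
elim: w => [|x w IH] //= /andP[x1 /IH <-]; rewrite /long_sum /=.
by case: x x1 => [|[|x]] //= _; lia.
Qed.

Lemma long_sum_le w : long_sum w <= sumn w.
Proof. by elim: w => [|x w]; rewrite /long_sum //=; case: ifP => /=; lia. Qed.

Lemma long_sum_neq1 w : long_sum w != 1.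
Proof.
elim: w => [|x w IH] //; rewrite /long_sum /=.
by case: ifP => //=; lia.
Qed.

Section HalfCost.

Variable g : nat -> nat.
Hypothesis g_mono : forall i, g i <= g i.+1.
Hypothesis g_conc : forall i, g i + g i.+2 <= (g i.+1).*2.

(** The cost of packing long steps of total length [mu] against position 0 as
cheaply as possible: steps 2 skipping 1, 3, 5, ..., or a step 3 and then steps 2,
skipping 1, 2, 4, 6, ... The share 1 is unattainable, and gets the cost of 2. *)
Fixpoint half_min (mu : nat) : nat :=
  match mu with
  | 0 => 0
  | 1 => g 1
  | mu'.+2 => g mu'.+1 + half_min mu'
  end.

Lemma half_minSS mu : half_min mu.+2 = g mu.+1 + half_min mu.
Proof. by []. Qed.

Lemma g_homo i j : i <= j -> g i <= g j.
Proof.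
move=> /subnKC <-; elim: (j - i) => [|d IH]; first by rewrite addn0.
by rewrite addnS; apply: leq_trans IH (g_mono _).
Qed.

(** Proved for two consecutive arguments at a time, as the recursion has depth
two. *)
Lemma half_min_mono mu : half_min mu <= half_min mu.+1.
Proof.
suff: half_min mu <= half_min mu.+1 /\ half_min mu.+1 <= half_min mu.+2 by case.
elim: mu => [|mu [IH1 IH2]]; first by rewrite /= addn0; split.
split=> //; move: IH1 IH2 => /=; have := g_mono mu.+1; lia.
Qed.

Lemma half_min_homo mu nu : mu <= nu -> half_min mu <= half_min nu.
Proof.
move=> /subnKC <-; elim: (nu - mu) => [|d IH]; first by rewrite addn0.
by rewrite addnS; apply: leq_trans IH (half_min_mono _).
Qed.

(** By induction on [x]. The last position skipped pays for one unfolding of the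
recursion, which lowers the argument by 2, while dropping it shortens the step by
1 only; monotonicity closes the gap. *)
Lemma half_min_block mu a x : mu <= a -> 1 < x ->
  half_min (mu + x) <= half_min mu + \sum_(a.+1 <= i < a + x) g i.
Proof.
move=> mua; case: x => [|[|x]] // _; elim: x => [|x IH].
  rewrite !addnS !addn0 big_nat1 /= addnC leq_add2l.
  by apply: g_homo; lia.
rewrite addnS [a + _]addnS big_nat_recr; last by lia.
rewrite /= -[mu + x.+2]/(mu + x.+2) !addnS /= in IH *.
have := @g_homo (mu + x).+2 (a + x).+2.
have := half_min_mono (mu + x).+1; rewrite /=.
lia.
Qed.

(** The invariant [mu <= a] says that the long steps read so far fit into the
distance walked, so each new position skipped is at least as dear as the one that
the packed word would skip. *)
Lemma half_min_cost mu a w : mu <= a ->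
  half_min (mu + long_sum w) <= half_min mu + cost g a w.
Proof.
elim: w mu a => [|x w IH] mu a mua; first by rewrite /long_sum /= !addn0.
rewrite /long_sum /=; case: ifP => x1 /=.
  rewrite addnA; have := IH (mu + x) (a + x); rewrite /long_sum.
  have := half_min_block mua x1; lia.
have := IH mu (a + x); rewrite /long_sum; lia.
Qed.

(** A step straddling the middle is cut into two pieces which together are one
longer than the step; the bound with [x.-1] gives this unit back, and it
also covers a piece that skips nothing. *)
Lemma half_min_block1 mu a x : mu <= a ->
  half_min (mu + x.-1) <= half_min mu + \sum_(a.+1 <= i < a + x) g i.
Proof.
move=> mua; case: (ltnP 1 x) => x1; last first.
  by rewrite (_ : x.-1 = 0) ?addn0 ?leq_addr //; lia.
apply: leq_trans (half_min_block mua x1).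
by apply: half_min_homo; lia.
Qed.

(** The cost is taken for the profile mirrored about the middle, so each half is
bounded by [half_min_cost] from its own end. *)
Lemma two_halves N w : sumn w = N -> all (leq 1) w ->
  exists mu nu, mu + nu = long_sum w /\
    half_min mu + half_min nu <= cost (fun i => g (minn i (N - i))) 0 w.
Proof.
move=> sw w1; have [N0|Npos] := posnP N.
  case: w sw w1 => [|x w] /=; last by lia.
  by exists 0, 0.
set h := N./2; have hN : h < N by lia.
(* [x] is the step that leaves the left half. *)
have [u [x [v [wE au ax]]]] : exists u x v, [/\ w = u ++ x :: v,
    sumn u <= h & h < sumn u + x].
  move: sw hN {w1 Npos} => <-; move: (h) => h'.
  elim: w h' => [|y w IH] // {N h} h /= hy.
  case: (ltnP h y) => hyw.
    by exists [::], y, w.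
  have [|u [x [v [wE uh hx]]]] := IH (h - y); first by lia.
  by exists (y :: u), x, v; split; rewrite ?wE //=; lia.
subst w; rewrite cost_cat /= add0n long_sum_cat.
move: sw; rewrite sumn_cat /= => sw.
have x1 : 0 < x by case: (x) ax => //; lia.
have lx : long_sum (x :: v) = (if 1 < x then x else 0) + long_sum v.
  by rewrite /long_sum /=; case: ifP.
rewrite lx; set a := sumn u in au ax sw *; set b := sumn v in sw.
have cu : half_min (long_sum u) <= cost (fun i => g (minn i (N - i))) 0 u.
  rewrite (@eq_cost _ g) => [|i]; first exact: (@half_min_cost 0 0).
  by rewrite add0n -/a => hi; congr g; lia.
have cv : half_min (long_sum v) <= cost (fun i => g (minn i (N - i))) (a + x) v.
  rewrite (@eq_cost _ (fun i => g (N - i))) => [|i].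
    rewrite cost_rev -?addnA // -[long_sum v]long_sum_rev.
    exact: (@half_min_cost 0 0).
  by rewrite -/b => hi; congr g; lia.
have cx : \sum_(a.+1 <= i < a + x) g (minn i (N - i)) =
    \sum_(a.+1 <= i < a + (h.+1 - a)) g i
    + \sum_(b.+1 <= i < b + (N - h - b)) g i.
  rewrite (_ : a + (h.+1 - a) = h.+1); last by lia.
  rewrite (_ : b + (N - h - b) = N - h); last by lia.
  rewrite (@big_cat_nat _ _ _ h.+1) /=; [|by lia..]; congr (_ + _).
    by apply: eq_big_nat => i hi; congr g; lia.
  rewrite -{1}[h.+1]add0n big_addn big_nat_rev /=.
  rewrite -{1}[b.+1]add0n [RHS]big_addn.
  have -> : N - h - b.+1 = a + x - h.+1 by lia.
  by apply: eq_big_nat => i hi; congr g; lia.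
have ua : long_sum u <= a := long_sum_le u.
have vb : long_sum v <= b := long_sum_le v.
have B1 := half_min_block1 (h.+1 - a) ua.
have B2 := half_min_block1 (N - h - b) vb.
have B3 := @half_min_block _ _ (h.+1 - a) ua.
(* At least one piece of a long step [x] is itself long and can take the full
   [half_min_block]; the other one gives back the unit counted twice. *)
case: (ltnP 1 (h.+1 - a)) => hx.
  exists (long_sum u + (h.+1 - a)), (long_sum v + (N - h - b).-1).
  have -> : 1 < x by lia.
  split; first by lia.
  by move: (B3 hx); lia.
case: (ltnP 1 (N - h - b)) => hy; last first.
  exists (long_sum u), (long_sum v); split; last first.
    by rewrite cx; lia.
  by have -> : (1 < x) = false by lia.
exists (long_sum u), (long_sum v + (N - h - b)).
have -> : 1 < x by lia.
split; first by lia.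
by move: (@half_min_block _ _ _ vb hy); lia.
Qed.

(** Moving 2 from the larger share to the smaller one replaces a position by one
closer to the end. *)
Lemma half_min_shift2 p q i : p <= q.+2 -> i.*2 <= p ->
  half_min p + half_min q <= half_min (p - i.*2) + half_min (q + i.*2).
Proof.
move=> pq; elim: i => [|i IH] ip; first by rewrite subn0 addn0.
apply: leq_trans (IH _) _; first by lia.
rewrite doubleS !addnS /=.
have -> : p - i.*2 = (p - i.*2.+2).+2 by lia.
rewrite /=; have := @g_homo (p - i.*2.+2).+1 (q + i.*2).+1; lia.
Qed.

(** The only place where concavity enters: by induction it makes the increment of
[half_min] after an even argument at least the one after the next odd argument.
The increments after even arguments grow with the argument, since [g] is
nondecreasing. *)
Lemma half_min_odd_odd i j : i <= j ->
  half_min i.*2.+2 + half_min j.*2 <= half_min i.*2.+1 + half_min j.*2.+1.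
Proof.
have odd_conv : half_min i.*2 + half_min i.*2.+2 <= (half_min i.*2.+1).*2.
  elim: (i) => [|l IH]; first by rewrite double0 /=; lia.
  by rewrite doubleS !half_minSS in IH *; have := g_conc l.*2.+1; lia.
move=> /subnKC <-; elim: (j - i) => [|d IH]; first by rewrite addn0; lia.
move: IH; rewrite addnS doubleS !half_minSS.
by have := g_mono (i + d).*2.+1; lia.
Qed.

(** Two odd shares are first replaced by the even ones next to them, towards each
other; then [half_min_shift2] moves the shares by twos. *)
Lemma half_min_balanced p q mu nu : mu + nu = p + q ->
    p <= q.+2 -> q <= p.+2 -> ~~ odd p || ~~ odd q ->
  half_min p + half_min q <= half_min mu + half_min nu.
Proof.
have same_parity mu' nu' p' q' : mu' + nu' = p' + q' -> p' <= q'.+2 ->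
    q' <= p'.+2 -> odd mu' = odd p' ->
    half_min p' + half_min q' <= half_min mu' + half_min nu'.
  move=> s pq qp par; case: (leqP mu' p') => le.
    have := @half_min_shift2 p' q' (p' - mu')./2 pq.
    have -> : ((p' - mu')./2).*2 = p' - mu' by lia.
    by rewrite subKn // (_ : q' + _ = nu'); lia.
  have := @half_min_shift2 q' p' (mu' - p')./2 qp.
  have -> : ((mu' - p')./2).*2 = mu' - p' by lia.
  rewrite (_ : q' - _ = nu'); last by lia.
  rewrite (_ : p' + _ = mu'); lia.
move=> s pq qp par; wlog le : mu nu s / mu <= nu.
  move=> H; case: (leqP mu nu) => le; first exact: H.
  by rewrite [leqRHS]addnC; apply: H; [rewrite addnC | exact: ltnW].
case: (boolP (odd mu == odd p)) => [/eqP|] opm; first exact: same_parity.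
case: (boolP (odd mu == odd q)) => [/eqP|] oqm.
  by rewrite addnC; apply: same_parity => //; rewrite s addnC.
have := @half_min_odd_odd mu./2 nu./2.
have -> : mu./2.*2.+2 = mu.+1 by lia.
have -> : mu./2.*2.+1 = mu by lia.
have -> : nu./2.*2.+1 = nu by lia.
have -> : nu./2.*2 = nu.-1 by lia.
move=> le'; have {}le' := le' (half_leq le).
apply: leq_trans le'; apply: same_parity => //=; lia.
Qed.

End HalfCost.

(** The word of the extremal caterpillar, with the cheapest packings of [p] and
[q] at the two ends. Only [p] may be odd. *)
Definition split_word (p q z : nat) : seq nat :=
  (if odd p then 3 :: nseq (p - 3)./2 2 else nseq p./2 2)
  ++ nseq z 1 ++ nseq q./2 2.

Lemma cost_nseq1 g a z : cost g a (nseq z 1) = 0.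
Proof. by elim: z a => [|z IH] a //=; rewrite IH big_geq //; lia. Qed.

(** Stated additively in [half_min] to absorb the start of the walk, be it 0 or
just after a step 3. *)
Lemma cost_twos g a i :
  half_min g (a + i.*2) = half_min g a + cost g a (nseq i 2).
Proof.
elim: i a => [|i IH] a /=; first by rewrite !addn0.
rewrite doubleS !addnS !addn0 big_nat1.
have := IH a.+2; rewrite !addSn !half_minSS; lia.
Qed.

Lemma sumn_split_word p q z : ~~ odd q -> (odd p -> 2 < p) ->
  sumn (split_word p q z) = p + z + q.
Proof.
by rewrite /split_word !sumn_cat !sumn_nseq; case: ifP => /=;
  rewrite ?sumn_nseq; lia.
Qed.

Lemma count1_split_word p q z : count_mem 1 (split_word p q z) = z.
Proof.
rewrite /split_word !count_cat !count_nseq /=.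
by case: ifP => /=; rewrite ?count_nseq /=; lia.
Qed.

Lemma all_split_word p q z : all (leq 1) (split_word p q z).
Proof.
rewrite /split_word !all_cat !all_nseq !orbT !andbT.
by case: ifP; rewrite /= all_nseq orbT.
Qed.

Lemma cost_split_word g p q z : ~~ odd q -> (odd p -> 2 < p) ->
    p <= q.+2 -> q <= p.+2 ->
  cost (fun i => g (minn i (p + z + q - i))) 0 (split_word p q z)
  = half_min g p + half_min g q.
Proof.
move=> oq p3 pq qp; set N := p + z + q.
have sN := sumn_split_word z oq p3; rewrite -/N in sN.
have -> : half_min g q = cost g 0 (nseq q./2 2).
  by rewrite -[RHS]/(half_min g 0 + cost g 0 _) -cost_twos; congr half_min; lia.
set l := if odd p then 3 :: nseq (p - 3)./2 2 else nseq p./2 2.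
have sl : sumn l = p.
  rewrite /l; case: ifP => op /=; rewrite sumn_nseq; last by lia.
  by have := p3 op; lia.
have -> : half_min g p = cost g 0 l.
  rewrite /l; case: ifP => op /=.
    have -> : p = 3 + ((p - 3)./2).*2 by have := p3 op; lia.
    rewrite cost_twos add0n /= (_ : (_ - 3)./2 = (p - 3)./2); last by lia.
    by rewrite big_nat_recl // big_nat1 /=; lia.
  by rewrite -[RHS]/(half_min g 0 + cost g 0 _) -cost_twos; congr half_min; lia.
rewrite /split_word -/l !cost_cat cost_nseq1 sumn_nseq sl !add0n mul1n.
congr (_ + _).
  by apply: eq_cost => i; rewrite add0n sl => hi; congr g; lia.
rewrite (@eq_cost _ (fun i => g (N - i))) => [|i]; last first.
  by rewrite sumn_nseq => hi; congr g; lia.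
rewrite cost_rev ?sumn_nseq; last by lia.
by congr cost; apply: (@eq_from_nth _ 0) => [|i]; rewrite size_rev // =>
  hi; rewrite nth_rev // !nth_nseq size_nseq; rewrite size_nseq in hi;
  rewrite hi (_ : _ < _) //; lia.
Qed.

Lemma size_split_word p q z : (odd p -> 2 < p) ->
  size (split_word p q z) = p./2 + z + q./2.
Proof.
move=> p3; rewrite /split_word !size_cat !size_nseq addnA; do 2!congr (_ + _).
by case: ifP => [op|_]; rewrite /= size_nseq //; have := p3 op; lia.
Qed.

Lemma nth_split_word p q z j : (odd p -> 2 < p) -> j < p./2 + z + q./2 ->
  nth 0 (split_word p q z) j =
    if j < p./2 then (if odd p && (j == 0) then 3 else 2)
    else if j < p./2 + z then 1 else 2.
Proof.
move=> p3 jw; rewrite /split_word nth_cat.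
have -> : size (if odd p then 3 :: nseq (p - 3)./2 2 else nseq p./2 2) = p./2.
  by case: ifP => [op|_]; rewrite /= size_nseq //; have := p3 op; lia.
case: ltnP => jp.
  case: ifP => [op|_]; last by rewrite nth_nseq jp.
  have {}p3 := p3 op.
  by case: j {jw} jp => // j jp; rewrite /= nth_nseq (_ : j < _) //; lia.
rewrite nth_cat size_nseq !nth_nseq; case: ltnP => jz.
  by rewrite (_ : j < _) //; lia.
by rewrite (_ : (j < _) = false); [rewrite (_ : _ < _) //|]; lia.
Qed.

(** * Forests, spines and straightening *)

(** First-child, next-sibling encoding: [Fcons c s] is a tree whose root has the
forest [c] of child subtrees, followed by the forest [s] of its siblings. This
avoids a nested inductive type. *)
Inductive forest : Type := Fnil | Fcons of forest & forest.

Definition is_nil c := if c is Fnil then true else false.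
Definition is_single c := if c is Fcons _ Fnil then true else false.

Fixpoint fsize c := if c is Fcons c' s then (fsize c').+1 + fsize s else 0.

(** The nodes with exactly one child; below an edge they are the vertices of
degree 2. *)
Fixpoint funary c :=
  if c is Fcons c' s then is_single c' + funary c' + funary s else 0.

(** Caterpillars are the spines with bare hanging forests. *)
Fixpoint bare c := if c is Fcons c' s then is_nil c' && bare s else true.

(** A spine is the list of the forests hanging off the inner vertices of a path
between two leaves. [descend c] is the path that goes down from a node with child
forest [c] through first children, listed from its bottom leaf up; so the node
itself is the last entry. *)
Fixpoint descend c := if c is Fcons c' s then rcons (descend c') s else [::].

(** The two end leaves of the path are not counted. *)
Definition ssize (s : seq forest) := sumn [seq (fsize h).+1 | h <- s].
Definition sunary (s : seq forest) := sumn [seq is_nil h + funary h | h <- s].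

Lemma ssize_cat s1 s2 : ssize (s1 ++ s2) = ssize s1 + ssize s2.
Proof. by rewrite /ssize map_cat sumn_cat. Qed.

Lemma sunary_cat s1 s2 : sunary (s1 ++ s2) = sunary s1 + sunary s2.
Proof. by rewrite /sunary map_cat sumn_cat. Qed.

Lemma ssize_rev s : ssize (rev s) = ssize s.
Proof. by rewrite /ssize map_rev sumn_rev. Qed.

Lemma sunary_rev s : sunary (rev s) = sunary s.
Proof. by rewrite /sunary map_rev sumn_rev. Qed.

Lemma size_le_ssize s : size s <= ssize s.
Proof. by elim: s => //= h s; rewrite /ssize /=; lia. Qed.

Lemma ssize_descend c : ssize (descend c) = fsize c.
Proof.
elim: c => //= c IH s _.
by rewrite -cats1 ssize_cat IH /ssize /= addn0; lia.
Qed.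

Lemma sunary_descend c : sunary (descend c) = is_single c + funary c.
Proof.
elim: c => //= c IH s _.
by rewrite -cats1 sunary_cat IH /sunary /= addn0; case: (s) => /=; lia.
Qed.

Lemma size_descend_gt0 c : is_nil c = false -> 0 < size (descend c).
Proof. by case: c => //= c s _; rewrite size_rcons. Qed.

(** [n] is the number of vertices, and an edge with [a] vertices on one side has
weight [F a]. *)
Section EdgeFunction.

Variables (n : nat) (F : nat -> nat).
Hypothesis F_sym : forall a, a <= n -> F (n - a) = F a.
Hypothesis F_mono : forall a, a + a.+1 <= n -> F a <= F a.+1.
Hypothesis F_conc : forall a, a.+2 <= n -> F a + F a.+2 <= (F a.+1).*2.

Lemma F_le x y : x <= y -> x + y <= n -> F x <= F y.
Proof.
have low b : b.*2 <= n -> forall a, a <= b -> F a <= F b.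
  elim: b => [|b IH] bn a ab; first by rewrite (_ : a = 0) //; lia.
  have [->//|ab'] := eqVneq a b.+1.
  apply: leq_trans (IH _ _ _) (F_mono _); lia.
move=> xy xyn; case: (leqP y.*2 n) => yn; first exact: low.
by rewrite -[F y]F_sym; [apply: low; lia | lia].
Qed.

Fixpoint fsum c :=
  if c is Fcons c' s then F (fsize c').+1 + fsum c' + fsum s else 0.

(** The total weight of a spine with [a] vertices on the left of its first edge;
each entry accounts for the path edge on its left, and the last [F a] for the
right end of the path. *)
Fixpoint spine_sum a s :=
  if s is h :: s' then F a + fsum h + spine_sum (a + (fsize h).+1) s' else F a.

(** [spine_sum] for a spine whose hanging forests are [x.-1] pendant vertices. *)
Fixpoint word_sum a w :=
  if w is x :: w' then F a + x.-1 * F 1 + word_sum (a + x) w' else F a.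

Lemma spine_sum_cat a s1 h s2 :
  spine_sum a (s1 ++ h :: s2) =
    spine_sum a s1 + fsum h + spine_sum (a + ssize s1 + (fsize h).+1) s2.
Proof.
elim: s1 a => [|h1 s1 IH] a /=; first by rewrite addn0.
by rewrite IH /ssize /= !addnA; congr (_ + spine_sum _ _); lia.
Qed.

Lemma spine_sum_rev a b s :
  a + ssize s + b = n -> spine_sum a s = spine_sum b (rev s).
Proof.
elim: s a => [|h s IH] a; rewrite /ssize /= => sz.
  by rewrite -F_sym; [congr F; lia | lia].
rewrite -/(ssize s) in sz.
rewrite rev_cons -cats1 spine_sum_cat ssize_rev /= -(IH (a + (fsize h).+1)).
  rewrite -[F a]F_sym; last by lia.
  by rewrite (_ : n - a = b + ssize s + (fsize h).+1); lia.
by lia.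
Qed.

(** A subtree hung at the left end of a spine may be traversed along the spine. *)
Lemma spine_sum_descend c s :
  spine_sum 1 (descend c ++ s) = fsum c + spine_sum (fsize c).+1 s.
Proof.
elim: c s => [|c IHc t _] s //=.
rewrite cat_rcons IHc /= !addnA [F _ + fsum c]addnC.
by congr (_ + spine_sum _ _); lia.
Qed.

(** [B] is the forest of branches that can be moved away from a neighbour of the
spine; [h'] is what is left of [h]. *)
Lemma prune h : ~~ bare h -> exists B h',
  [/\ is_nil B = false, fsize h = fsize h' + fsize B,
      fsum h + F 1 = fsum h' + fsum B + F (fsize B).+1,
      funary h = funary h' + is_single B + funary B
    & is_nil h = is_nil h'].
Proof.
elim: h => [|B _ s IH] //=; case nB: (is_nil B) => /=; last first.
  move=> _; exists B, (Fcons Fnil s); split=> //=; lia.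
case: B nB => //= _ /IH[B [h' [nB sz sm un _]]].
by exists B, (Fcons Fnil h'); split=> //=; lia.
Qed.

(** Adding [b] vertices on the left does not decrease the weights as long as the
edges stay, after the addition, at least as central as they were. *)
Lemma spine_sum_shift a b s : (a + ssize s).*2 + b <= n ->
  spine_sum a s <= spine_sum (a + b) s.
Proof.
elim: s a => [|h s IH] a; rewrite /ssize /= => sz.
  by apply: F_le; lia.
have := IH (a + (fsize h).+1).
rewrite (_ : a + b + (fsize h).+1 = a + (fsize h).+1 + b); last by lia.
have := @F_le a (a + b); rewrite /ssize; lia.
Qed.

(** The branches [B] go to the left end, which becomes an inner vertex with the
degree that their former parent had. The weight lost on the edge of that parent is
regained on the first edge of the spine, and the other edges along [s1] do not
lose by [spine_sum_shift]. *)
Lemma reattach s1 h s2 : ssize (s1 ++ h :: s2) + 2 = n -> ~~ bare h ->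
    ssize s1 <= ssize s2 ->
  exists s, [/\ size (s1 ++ h :: s2) < size s,
    ssize s = ssize (s1 ++ h :: s2), sunary s = sunary (s1 ++ h :: s2)
    & spine_sum 1 (s1 ++ h :: s2) <= spine_sum 1 s].
Proof.
move=> sn nbh le12; have [B [h' [nB sz sm un nh]]] := prune nbh.
exists (descend B ++ s1 ++ h' :: s2); split.
- by rewrite [ltnRHS]size_cat /= !size_cat /=; have := size_descend_gt0 nB; lia.
- by rewrite [LHS]ssize_cat ssize_descend !ssize_cat /ssize /=; lia.
- rewrite [LHS]sunary_cat sunary_descend !sunary_cat /sunary /= nh; lia.
rewrite spine_sum_descend !spine_sum_cat.
rewrite (_ : 1 + ssize s1 + _ = (fsize B).+1 + ssize s1 + (fsize h').+1);
  last by lia.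
suff: spine_sum 1 s1 + F (fsize B).+1 <= spine_sum (fsize B).+1 s1 + F 1 by lia.
move: sn; rewrite ssize_cat; case: s1 le12 => [|h1 s1] /=; first by lia.
have -> : ssize (h1 :: s1) = (fsize h1).+1 + ssize s1 by [].
rewrite /ssize /= -/(ssize s1) -/(ssize s2) => le12 sn.
have := @spine_sum_shift (1 + (fsize h1).+1) (fsize B) s1.
rewrite (_ : (fsize B).+1 + _ = 1 + (fsize h1).+1 + fsize B); lia.
Qed.

(** Repeat [reattach], on the reversed spine when the right side is the smaller
one. The spine gets longer each time, and it has at most [n] entries. *)
Lemma straighten s : ssize s + 2 = n -> exists w,
  [/\ all (leq 1) w, sumn w = ssize s, count_mem 1 w = sunary s
    & spine_sum 1 s <= word_sum 1 w].
Proof.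
have [l] := ubnP (n - size s); elim: l s => [|l IH] s; first by lia.
move=> sl sn; case: (boolP (all bare s)) => [bs|nbs].
  exists [seq (fsize h).+1 | h <- s]; split=> //.
  - by rewrite all_map; elim: (s).
  - rewrite /sunary; elim: s bs {sl sn} => //= h s IHs /andP[bh /IHs ->].
    congr (_ + _); case: h bh => //= c t /andP[]; case: c => //= _.
    by elim: t => //= c _ t IHt /andP[]; case: c => //=; lia.
  - elim: s bs 1 {sl sn} => //= h s IHs /andP[bh /IHs {}IHs] a.
    rewrite leq_add // leq_add2l {IHs}.
    elim: h bh => //= c _ t IHt /andP[]; case: c => //= _ /IHt /=.
    by rewrite mulSn; lia.
have [s1 [h [s2 [sE nbh]]]] : exists s1 h s2, s = s1 ++ h :: s2 /\ ~~ bare h.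
  elim: s nbs {sl sn} => //= h s IHs; rewrite negb_and.
  case: (boolP (bare h)) => [_ /= /IHs [s1 [h' [s2 [-> nb]]]]|nb _].
    by exists (h :: s1), h', s2.
  by exists [::], h, s.
have [s' [szs' ss' us' le]] : exists s', [/\ size s < size s',
    ssize s' = ssize s, sunary s' = sunary s & spine_sum 1 s <= spine_sum 1 s'].
  rewrite {}sE in sl sn *; case: (leqP (ssize s1) (ssize s2)) => [|/ltnW] le12.
    exact: reattach.
  have rE : rev (s1 ++ h :: s2) = rev s2 ++ h :: rev s1.
    by rewrite rev_cat rev_cons cat_rcons.
  have := @reattach (rev s2) h (rev s1); rewrite -rE !ssize_rev.
  move=> /(_ sn nbh le12)[s' [H1 H2 H3 H4]].
  exists s'; rewrite -(size_rev (s1 ++ _)) -(sunary_rev (s1 ++ _)); split=> //.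
  by rewrite (@spine_sum_rev 1 1) //; lia.
have [||w [w1 sw cw lew]] := IH s'; [|by lia|].
  by have := size_le_ssize s'; lia.
exists w; rewrite -ss' -us'; split=> //; exact: leq_trans le lew.
Qed.

(** The profile of the cost of skipped positions, kept constant beyond the middle:
this makes it nondecreasing and concave on all of [nat]. *)
Definition skip_gain y := F (minn y (n - 2)./2).+1 - F 1.

Lemma skip_gain_mono y : skip_gain y <= skip_gain y.+1.
Proof.
apply: leq_sub2r; case: (leqP (n - 2)./2 y) => hy; last by apply: F_le; lia.
by rewrite !(minn_idPr _); [ | lia..].
Qed.

Lemma skip_gain_conc y :
  skip_gain y + skip_gain y.+2 <= (skip_gain y.+1).*2.
Proof.
have := skip_gain_mono y; rewrite /skip_gain.
case: (leqP (n - 2)./2 y.+1) => hy; first by rewrite (minn_idPr (leqW hy)); lia.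
move=> _; rewrite !(minn_idPl _); [|lia..].
have := @F_conc y.+1; have := @F_le 1 y.+1; have := @F_le 1 y.+2.
have := @F_le 1 y.+3; lia.
Qed.

(** Position [i] is a vertex count [i.+1] on the left of an edge. Each position in
the range contributes either a spine edge or, when skipped, a pendant edge of
weight [F 1]. *)
Lemma word_sum_cost w : all (leq 1) w -> sumn w + 2 = n ->
  word_sum 1 w + cost (fun i => skip_gain (minn i (n - 2 - i))) 0 w
  = \sum_(1 <= i < n) F i.
Proof.
move=> w1 sw; rewrite (@eq_cost _ (fun i => F i.+1 - F 1)) => [|i]; last first.
  rewrite add0n /skip_gain => hi; case: (leqP i (n - 2)./2) => hi2.
    by rewrite (_ : minn _ _ = i) //; lia.
  by rewrite (_ : (minn _ _).+1 = n - i.+1) ?F_sym //; lia.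
suff H a : a + sumn w + 2 <= n ->
    word_sum a.+1 w + cost (fun i => F i.+1 - F 1) a w
    = \sum_(a.+1 <= i < (a + sumn w).+2) F i.
  by rewrite H; [rewrite (_ : (0 + sumn w).+2 = n); lia | lia].
elim: w a w1 {sw} => [|x w IH] a /=; first by rewrite !addn0 big_nat1.
move=> /andP[x1 w1]; rewrite addnA => sz; have {}IH := IH _ w1 sz.
rewrite addSn [RHS](@big_cat_nat _ _ _ (a + x).+1) /=; [|lia..].
rewrite -IH.
rewrite (@big_ltn _ _ _ a.+1 (a + x).+1) /=; last by lia.
have <- : x.-1 * F 1 + \sum_(a.+1 <= i < a + x) (F i.+1 - F 1)
    = \sum_(a.+2 <= i < (a + x).+1) F i.
  rewrite [RHS]big_add1 /=.
  have -> : x.-1 * F 1 = \sum_(a.+1 <= i < a + x) F 1.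
    by rewrite sum_nat_const_nat; congr (_ * _); lia.
  rewrite -big_split /=; apply: eq_big_nat => i hi.
  by rewrite subnKC //; apply: F_le; lia.
lia.
Qed.

Lemma split_word_optimal w p q : all (leq 1) w -> sumn w + 2 = n ->
    p + q = long_sum w -> ~~ odd q -> (odd p -> 2 < p) ->
    p <= q.+2 -> q <= p.+2 ->
  word_sum 1 w <= word_sum 1 (split_word p q (count_mem 1 w)).
Proof.
move=> w1 sw pq oq p3 le1 le2; set z := count_mem 1 w.
have wN := long_sum_count1 w1; rewrite -/z in wN.
have sN := sumn_split_word z oq p3.
have E1 := word_sum_cost w1 sw.
have := @word_sum_cost (split_word p q z) (all_split_word _ _ _).
rewrite sN (_ : n - 2 = p + z + q); last by lia.
rewrite cost_split_word // => /(_ ltac:(lia)) E2.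
have [|mu [nu [mn le]]] := @two_halves skip_gain skip_gain_mono (n - 2) w _ w1.
  by lia.
have := @half_min_balanced skip_gain skip_gain_mono skip_gain_conc p q mu nu.
rewrite oq orbT mn pq => /(_ erefl le1 le2 isT); lia.
Qed.

Lemma spine_bound s p q : ssize s + 2 = n -> p + q + sunary s = ssize s ->
    ~~ odd q -> (odd p -> 2 < p) -> p <= q.+2 -> q <= p.+2 ->
  spine_sum 1 s <= word_sum 1 (split_word p q (sunary s)).
Proof.
move=> sn pq oq p3 le1 le2; have [v [v1 sv cv le]] := straighten sn.
have lv := long_sum_count1 v1.
by apply: leq_trans le _; rewrite -cv; apply: split_word_optimal => //; lia.
Qed.

End EdgeFunction.

(** [M] is the total of the letters of at least 2 in the word of the straightened
spine, obtained here with weights 0. This is why no tree has exactly two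
segments. *)
Lemma sunary_total s : exists2 M, M + sunary s = ssize s & M != 1.
Proof.
have [|||v [v1 sv cv _]] := @straighten (ssize s + 2) (fun => 0) _ _ s => //.
by exists (long_sum v); rewrite ?long_sum_neq1 // -cv -sv long_sum_count1.
Qed.

(** * Rooted trees *)

(** The edges join each vertex other than [r] to its parent; the rank, which
increases away from the root, makes the parent map well-founded. *)
Definition rooted (G : sgraph) (r : G) (up : G -> G) (rk : G -> nat) : Prop :=
  [/\ up r = r, forall x, x != r -> rk (up x) < rk x
    & forall x y, edge x y = ((x != r) && (y == up x)) || ((y != r) && (x == up y))].

(** Let the parent be a neighbour closer to [r]. The parent edges connect the
graph, so any other edge would close a cycle. *)
Lemma tree_rooted (G : sgraph) (r : G) :
  is_tree G -> exists up rk, rooted r up rk.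
Proof.
move=> [[_ conG] acG].
pose P x n := [exists p : n.-tuple G, path (@edge G) x p && (last x p == r)].
have exP x : exists n, P x n.
  have /connectP[p pp lp] := conG x r.
  by exists (size p); apply/existsP; exists (in_tuple p); rewrite /= pp -lp eqxx.
pose rk x := ex_minn (exP x).
have rkle x p : path (@edge G) x p -> last x p = r -> rk x <= size p.
  move=> pp lp; rewrite /rk; case: ex_minnP => n _; apply.
  by apply/existsP; exists (in_tuple p); rewrite /= pp lp eqxx.
have lower x : x != r -> exists y, edge x y && (rk y < rk x).
  move=> xr; rewrite {2}/rk; case: ex_minnP => n /existsP[[p /= sp]].
  case: p sp => [|y p] /= sp; rewrite ?(negPf xr) // => /andP[].
  move=> /andP[exy pp] /eqP lp _; exists y; rewrite exy -(eqP sp) /= ltnS.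
  exact: rkle.
pose up x := if x == r then r else odflt r [pick y | edge x y && (rk y < rk x)].
have upP x : x != r -> edge x (up x) /\ rk (up x) < rk x.
  move=> xr; rewrite /up (negPf xr); case: pickP => [y /andP[] //|none] /=.
  by have [y] := lower x xr; rewrite none.
exists up, rk.
pose e x y := ((x != r) && (y == up x)) || ((y != r) && (x == up y)).
have e_sym : symmetric e by move=> x y; rewrite /e orbC.
have e_edge x y : e x y -> edge x y.
  case/orP=> /andP[xr /eqP->]; first by case: (upP _ xr).
  by rewrite edge_sym; case: (upP _ xr).
have e_root x : connect e x r.
  have [l] := ubnP (rk x); elim: l x => // l IH x xl.
  have [->|xr] := eqVneq x r; first exact: connect0.
  have [_ lt] := upP _ xr.
  apply: (connect_trans (y := up x)); last by apply: IH; lia.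
  by apply: connect1; rewrite /e xr eqxx.
have e_con x y : connect e x y.
  apply: connect_trans (e_root x) _.
  by rewrite (sym_connect_sym e_sym); apply: e_root.
split; first by rewrite /up eqxx.
  by move=> x /upP[].
move=> x y; rewrite -/(e x y); apply/idP/idP; last exact: e_edge.
move=> exy; apply: contraT => nexy.
have /connectP[p0 pp0 ly0] := e_con x y.
case/shortenP: pp0 ly0 => p pp up' _ ly.
have := acG (x :: p).
rewrite /ucycle up' andbT /= rcons_path -ly edge_sym exy andbT.
rewrite (sub_path e_edge pp).
move=> /(_ isT); case: p pp up' ly => [|z [|z' p]] //=.
  by move=> _ _ xy; rewrite -xy edge_irrefl in exy.
by rewrite andbT => exz _ yz _; rewrite yz exz in nexy.
Qed.

Section Rooted.

Variables (G : sgraph) (r : G) (up : G -> G) (rk : G -> nat).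
Hypothesis Grooted : rooted r up rk.

Let up_root : up r = r. Proof. by case: Grooted. Qed.
Let rk_up x : x != r -> rk (up x) < rk x.
Proof. by case: Grooted => _ + _; apply. Qed.
Let edgeE x y :
  edge x y = ((x != r) && (y == up x)) || ((y != r) && (x == up y)).
Proof. by case: Grooted. Qed.

Lemma rooted_ind (P : G -> Prop) :
  P r -> (forall x, x != r -> P (up x) -> P x) -> forall x, P x.
Proof.
move=> Pr Pup x; have [l] := ubnP (rk x); elim: l x => // l IH x xl.
have [->//|xr] := eqVneq x r; apply: Pup => //.
by apply: IH; have := rk_up xr; lia.
Qed.

Lemma rooted_connected : connected_graph G.
Proof.
have con x : connect (@edge G) x r.
  elim/rooted_ind: x => [|x xr]; first exact: connect0.
  by apply: connect_trans; apply: connect1; rewrite edgeE xr eqxx.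
split=> [|x y]; first by apply/card_gt0P; exists r.
apply: connect_trans (con x) _.
by rewrite (sym_connect_sym (@edge_sym G)); apply: con.
Qed.

Lemma edge_top x y : edge x y -> rk y <= rk x -> y = up x.
Proof.
rewrite edgeE => /orP[/andP[_ /eqP]|/andP[yr /eqP xE]] //.
by have := rk_up yr; rewrite -xE; lia.
Qed.

(** Both neighbours on a cycle of a vertex of maximal rank would be its parent. *)
Lemma rooted_acyclic : acyclic G.
Proof.
move=> c uc; rewrite leqNgt; apply/negP => sc.
have x0c : head r c \in c by case: (c) sc => //= x s _; rewrite inE eqxx.
case: (arg_maxnP rk x0c) => x xc xmax.
have [i p cE] := rot_to xc.
have : ucycle (@edge G) (x :: p) by rewrite -cE rot_ucycle.
have sp : 1 < size p by rewrite -ltnS -[(size p).+1]/(size (x :: p)) -cE size_rot.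
have pmax y : y \in p -> rk y <= rk x.
  move=> yp; have yc : y \in c by rewrite -(mem_rot i) cE inE yp orbT.
  exact: xmax yc.
case: p sp pmax {cE} => [|y p] //= sp pmax.
rewrite /ucycle /= rcons_path => /andP[/and3P[exy _ elx] /and3P[_ yp _]].
have yE := edge_top exy (pmax _ (mem_head _ _)).
case/lastP: p sp pmax elx yp => //= p z _ pmax.
rewrite last_rcons edge_sym mem_rcons inE => exz.
rewrite (edge_top exz) -?yE ?eqxx //; apply: pmax.
by rewrite inE mem_rcons inE eqxx orbT.
Qed.

Lemma rooted_tree : is_tree G.
Proof. by split; [exact: rooted_connected | exact: rooted_acyclic]. Qed.

Definition desc v : {set G} := [set x | fconnect up x v].
Definition children v : {set G} := [set c | (c != r) && (up c == v)].

Lemma desc_refl v : v \in desc v.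
Proof. by rewrite inE connect0. Qed.

Lemma desc_up x v : up x \in desc v -> x \in desc v.
Proof.
rewrite !inE; apply: connect_trans; apply: connect1; exact: eqxx.
Qed.

Lemma descE x v : x \in desc v = (x == v) || ((x != r) && (up x \in desc v)).
Proof.
apply/idP/idP; last first.
  by case/predU1P=> [->|/andP[_]]; [exact: desc_refl | exact: desc_up].
have r_fix p : fpath up r p -> last r p = r.
  by elim: p => //= y p IH /andP[/eqP <-]; rewrite up_root.
rewrite !inE => /connectP[p pp ->].
have [xr|xr] := eqVneq x r; first by rewrite xr in pp *; rewrite r_fix // eqxx.
case: p pp => [|y p] /=; first by rewrite eqxx.
by move=> /andP[/eqP <- pp]; apply/orP; right; apply/connectP; exists p.
Qed.

Lemma desc_trans x y z : x \in desc y -> y \in desc z -> x \in desc z.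
Proof. by rewrite !inE; apply: connect_trans. Qed.

Lemma desc_root x : x \in desc r.
Proof.
elim/rooted_ind: x => [|x xr IH]; first exact: desc_refl.
by rewrite descE xr IH orbT.
Qed.

Lemma desc_rk x v : x \in desc v -> rk v <= rk x ?= iff (x == v).
Proof.
elim/rooted_ind: x => [|x xr IH]; rewrite descE.
  by rewrite eqxx orbF => /eqP->; split; rewrite ?eqxx.
case/predU1P=> [->|]; first by split; rewrite ?eqxx.
rewrite xr => /IH[le _]; have lt := rk_up xr; split; first by lia.
have [xv|_] := eqVneq x v; [by rewrite xv eqxx | by apply/eqP; lia].
Qed.

Lemma desc_anti x v : x \in desc v -> v \in desc x -> x = v.
Proof.
move=> /desc_rk[le /esym xv] /desc_rk[ge _]; apply/eqP; rewrite xv.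
by rewrite eqn_leq le ge.
Qed.

(** The ancestors of a vertex form a chain. *)
Lemma desc_comparable x v w :
  x \in desc v -> x \in desc w -> (v \in desc w) || (w \in desc v).
Proof.
elim/rooted_ind: x => [|x xr IH].
  by rewrite descE eqxx orbF => /eqP <- ->.
rewrite descE => /predU1P[-> -> //|/andP[_ xv]].
rewrite descE => /predU1P[<-|/andP[_ xw]]; last exact: IH.
by rewrite (desc_up xv) orbT.
Qed.

Lemma degreeE x : degree x = (x != r) + #|children x|.
Proof.
have -> : (x != r : nat) = #|[set y | (x != r) && (y == up x)]|.
  case: (x != r) => /=; last first.
    by apply/esym/eqP; rewrite cards_eq0; apply/eqP/setP => y; rewrite !inE.
  rewrite -(cards1 (up x)); congr #|pred_of_set _|.
  by apply/setP => y; rewrite !inE.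
rewrite -cardsUI [X in _ + #|pred_of_set X|](_ : _ = set0) ?cards0 ?addn0.
  congr #|pred_of_set _|; apply/setP => y; rewrite !inE edgeE.
  by rewrite (eq_sym (up y)).
apply/setP => y; rewrite !inE; apply/negP.
move=> /andP[/andP[xr /eqP yE] /andP[yr /eqP xE]].
by have := rk_up xr; have := rk_up yr; rewrite -yE xE; lia.
Qed.

(** The descendants of [v] other than [v] are partitioned by the children of
[v]. *)
Lemma desc_sum (val : G -> nat) v :
  \sum_(x in desc v) val x
  = val v + \sum_(c in children v) \sum_(x in desc c) val x.
Proof.
rewrite (bigD1 v) ?desc_refl //=; congr (_ + _).
have child_below c x : c \in children v -> x \in desc c ->
    (x \in desc v) && (x != v).
  rewrite inE => /andP[cr /eqP cv] xc.
  have cdv : c \in desc v by rewrite descE cr cv desc_refl orbT.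
  rewrite (desc_trans xc cdv) /=; apply: contraTneq xc => ->.
  apply/negP => vc; have := rk_up cr.
  by rewrite cv (desc_anti vc cdv) ltnn.
rewrite (exchange_big_dep [pred x | (x \in desc v) && (x != v)]) /=; last first.
  exact: child_below.
apply: eq_bigr => x /andP[xv xnv].
have [c cP xc] : exists2 c, c \in children v & x \in desc c.
  elim/rooted_ind: x xv xnv => [|x xr IH].
    by rewrite descE eqxx orbF => ->.
  rewrite descE => /predU1P[->|/andP[_ xv] xnv]; first by rewrite eqxx.
  have [uv|unv] := eqVneq (up x) v.
    by exists x; [rewrite inE xr uv eqxx | exact: desc_refl].
  by have [c cP xc] := IH xv unv; exists c => //; apply: desc_up.
rewrite (big_pred1 c) // => d; apply/idP/eqP => [/andP[dP xd]|->]; last by rewrite cP.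
wlog dc : c d cP xc dP xd / d \in desc c.
  move=> H; have /orP[|] := desc_comparable xd xc; first exact: H.
  by move/H => ->.
apply/eqP; apply: contraT => ncd; move: dc; rewrite descE (negPf ncd) /=.
move: dP; rewrite inE => /andP[_ /eqP->] /andP[_ vc].
by have := child_below c v cP vc; rewrite eqxx andbF.
Qed.

End Rooted.

(** * The Steiner Wiener index as a sum over edges *)

(** The number of [k]-sets that meet both sides of an edge with [a] vertices on
one side. *)
Definition edge_splits (n k a : nat) : nat := 'C(n, k) - ('C(a, k) + 'C(n - a, k)).

(** It makes the subtraction in [edge_splits] exact. *)
Lemma bin_superadditive k a b : 0 < k -> 'C(a, k) + 'C(b, k) <= 'C(a + b, k).
Proof.
case: k => // k _; elim: b => [|b IH]; first by rewrite bin0n !addn0.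
rewrite addnS !binS; have := @leq_bin2l b (a + b) k (leq_addl _ _); lia.
Qed.

Lemma edge_splits_sym n k a : a <= n -> edge_splits n k (n - a) = edge_splits n k a.
Proof. by move=> an; rewrite /edge_splits subKn // addnC. Qed.

Lemma edge_splits_mono n k a : 0 < k ->
  a + a.+1 <= n -> edge_splits n k a <= edge_splits n k a.+1.
Proof.
case: k => // k _ an; apply: leq_sub2l.
rewrite (_ : n - a = (n - a.+1).+1); last by lia.
by rewrite !binS; have := @leq_bin2l a (n - a.+1) k; lia.
Qed.

Lemma edge_splits_conc n k a : 0 < k -> a.+2 <= n ->
  edge_splits n k a + edge_splits n k a.+2 <= (edge_splits n k a.+1).*2.
Proof.
move=> k0 an; rewrite /edge_splits.
have sup b : b <= n -> 'C(b, k) + 'C(n - b, k) <= 'C(n, k).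
  by move=> bn; have := @bin_superadditive k b (n - b) k0; rewrite subnKC.
have := sup a; have := sup a.+1; have := sup a.+2.
case: k k0 {sup} => // k _.
rewrite (_ : n - a = (n - a.+2).+2); last by lia.
rewrite (_ : n - a.+1 = (n - a.+2).+1); last by lia.
rewrite !binS; have := @leq_bin2l a a.+1 k.
have := @leq_bin2l (n - a.+2) (n - a.+2).+1 k; lia.
Qed.

Section Steiner.

Variables (G : sgraph) (r : G) (up : G -> G) (rk : G -> nat).
Hypothesis Grooted : rooted r up rk.

Let rk_up x : x != r -> rk (up x) < rk x.
Proof. by case: Grooted => _ + _; apply. Qed.
Let edgeE x y :
  edge x y = ((x != r) && (y == up x)) || ((y != r) && (x == up y)).
Proof. by case: Grooted. Qed.

Local Notation desc := (desc up).

(** The vertices whose parent edge has vertices of [S] on both sides. *)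
Definition separating (S : {set G}) : {set G} :=
  [set v | [&& v != r, S :&: desc v != set0 & ~~ (S \subset desc v)]].

Lemma up_edge_inj : {in [pred v | v != r] &, injective (fun v => [set v; up v])}.
Proof.
move=> v w; rewrite !inE => vr wr /setP E.
move: (E v) (E w); rewrite !inE !eqxx /= => /esym/orP[/eqP-> //|/eqP vE].
case/orP=> /eqP wE //; have := rk_up vr; have := rk_up wr.
by rewrite -vE -wE; lia.
Qed.

(** If a subgraph lacks the edge above [v], then its connections do not leave the
set of descendants of [v]. *)
Lemma separating_le S H : steiner_sub S H -> #|separating S| <= #|H.2|.
Proof.
case/and3P=> /andP[He /forall_inP Hv] /andP[_ /forall_inP con] SH.
rewrite -(card_in_imset (f := fun v => [set v; up v])); last first.
  by move=> v w; rewrite !inE => /andP[vr _] /andP[wr _]; apply: up_edge_inj.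
apply/subset_leq_card/subsetP => E /imsetP[v]; rewrite inE.
case/and3P=> vr /set0Pn[x /setIP[xS xv]] /subsetPn[y yS yv] ->{E}.
apply: contraT => nH.
have /forall_inP/(_ _ (subsetP SH _ yS)) := con x (subsetP SH _ xS).
move=> cxy; suff cl : closed [rel a b | [set a; b] \in H.2] (mem (desc v)).
  by have := closed_connect cl cxy; rewrite [x \in _]xv [y \in _](negPf yv).
suff below a b : [set a; b] \in H.2 -> a \in desc v -> b \in desc v.
  move=> a b /= ab; apply/idP/idP; apply: below => //.
  by rewrite setUC.
move=> ab av; have eab : edge a b.
  move: (subsetP He _ ab); rewrite inE => /existsP[c /existsP[d /andP[ecd /eqP E]]].
  move/setP: E => E; move: (E c) (E d) ecd; rewrite !inE !eqxx /= orbT.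
  move=> /orP[]/eqP-> /orP[]/eqP->; rewrite ?edge_irrefl //.
  by rewrite edge_sym.
have vup c : c != r -> [set c; up c] \in H.2 -> (c \in desc v) = (up c \in desc v).
  move=> cr cH; rewrite (descE Grooted c) cr /=.
  by case: eqP => // cv; rewrite cv (negPf nH) in cH.
move: eab; rewrite edgeE => /orP[]/andP[cr /eqP E].
  by rewrite E -vup // -E.
by rewrite vup // -E // setUC.
Qed.

(** The separating edges, with their ends and [S], form a connected graph: from
any of these vertices climb as long as the edge above separates. The vertex
reached has all of [S] below it, and it is the same for all starting points, namely
the lowest common ancestor of [S]. *)
Lemma separating_subgraph S : S != set0 ->
  exists2 H, steiner_sub S H & #|H.2| <= #|separating S|.
Proof.
move=> /set0Pn[s0 s0S].
pose E := [set [set v; up v] | v in separating S].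
pose V := S :|: separating S :|: up @: separating S.
exists (V, E); last exact: leq_imset_card.
have sepP v : v \in separating S ->
    [/\ v != r, exists2 x, x \in S & x \in desc v & ~~ (S \subset desc v)].
  by rewrite inE => /and3P[vr /set0Pn[x /setIP[xS xv]] nS]; split=> //; exists x.
have VP x : x \in V -> [\/ x \in S, x \in separating S
    | exists2 v, v \in separating S & x = up v].
  rewrite !in_setU -orbA => /or3P[xS|xsep|/imsetP[v vsep ->]].
  - exact: Or31.
  - exact: Or32.
  - by apply: Or33; exists v.
have meetV x : x \in V -> exists2 y, y \in S & y \in desc x.
  case/VP=> [xS|/sepP[_ //]|[v /sepP[vr [y yS yv] _] ->]].
    by exists x => //; apply: desc_refl.
  exists y => //; apply: desc_trans yv _.
  by rewrite (descE Grooted) vr desc_refl orbT.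
pose e := [rel a b | [set a; b] \in E].
have e_sym : symmetric e by move=> a b; rewrite /= setUC.
have to_top x : x \in V -> exists t, [/\ t \in V, S \subset desc t & connect e x t].
  elim/(rooted_ind Grooted): x => [|x xr IH] xV.
    exists r; split=> //; apply/subsetP => y _; exact: (desc_root Grooted).
  case: (boolP (S \subset desc x)) => Sx; first by exists x.
  have xsep : x \in separating S.
    have [y yS yx] := meetV _ xV; rewrite inE xr Sx andbT /=.
    by apply/set0Pn; exists y; rewrite inE yS.
  have [|t [tV St ct]] := IH; first by rewrite !in_setU imset_f ?orbT.
  exists t; split=> //; apply: connect_trans ct; apply: connect1 => /=.
  by apply/imsetP; exists x.
have top_le t t' : t \in V -> S \subset desc t -> S \subset desc t' ->
    t' \in desc t -> t = t'.
  move=> tV St St' t't.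
  suff tt' : t \in desc t' by apply: (desc_anti Grooted).
  case/VP: tV => [tS|/sepP[_ _ /negP//]|[v /sepP[vr [y yS yv] nSv] tE]].
    exact: subsetP St' _ tS.
  have /orP[vt'|t'v] := desc_comparable Grooted yv (subsetP St' _ yS).
    move: vt'; rewrite (descE Grooted) vr -tE => /predU1P[vE|//].
    by rewrite vE St' in nSv.
  case/negP: nSv; apply/subsetP => z /(subsetP St') zt'.
  exact: desc_trans zt' t'v.
(* By comparability it is enough to exclude a strict inclusion, which
   [top_le] does. *)
have top_uniq t t' : t \in V -> t' \in V -> S \subset desc t ->
    S \subset desc t' -> t = t'.
  move=> tV t'V St St'.
  have /orP[] := desc_comparable Grooted (subsetP St _ s0S) (subsetP St' _ s0S).
    by move=> tt'; apply/esym; apply: top_le.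
  exact: top_le.
apply/and3P; split.
- apply/andP; split=> /=.
    apply/subsetP => F /imsetP[v /sepP[vr _ _] ->]; rewrite inE.
    apply/existsP; exists v; apply/existsP; exists (up v).
    by rewrite edgeE vr !eqxx.
  apply/forall_inP => F /imsetP[v vsep ->]; apply/subsetP => x.
  by rewrite !in_set2 !in_setU => /orP[]/eqP->; rewrite ?vsep ?imset_f ?orbT.
- apply/andP; split=> /=; first by apply/set0Pn; exists s0; rewrite !in_setU s0S.
  apply/forall_inP => x xV; apply/forall_inP => y yV.
  have [t [tV St ct]] := to_top x xV; have [t' [t'V St' ct']] := to_top y yV.
  apply: connect_trans ct _; rewrite (top_uniq t t') // (sym_connect_sym e_sym).
  exact: ct'.
- by apply/subsetP => x xS; rewrite !in_setU xS.
Qed.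

Lemma steiner_distE S : S != set0 -> steiner_dist S = #|separating S|.
Proof.
move=> S0; apply/eqP; rewrite eqn_leq; apply/andP; split.
  have [H SH le] := separating_subgraph S0.
  by apply: leq_trans le; apply: steiner_dist_min => //; apply: rooted_connected Grooted.
have [H SH ->] := steiner_dist_witness (rooted_connected Grooted) S.
exact: separating_le.
Qed.

Lemma card_split_sets k (D : {set G}) : 0 < k ->
  #|[set S : {set G} | (#|S| == k) && ((S :&: D != set0) && ~~ (S \subset D))]|
  = edge_splits #|G| k #|D|.
Proof.
move=> k0; rewrite /edge_splits.
pose A := [set S : {set G} | #|S| == k].
pose I := [set S : {set G} | S \subset D & #|S| == k].
pose O := [set S : {set G} | S \subset ~: D & #|S| == k].
have cI : #|I| = 'C(#|D|, k) by rewrite cards_draws.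
have cO : #|O| = 'C(#|G| - #|D|, k).
  by rewrite cards_draws; congr 'C(_, k); have := cardsC D; lia.
have cA : #|A| = 'C(#|G|, k) by rewrite card_draws.
have IO : I :&: O = set0.
  apply/setP => S; rewrite !inE; apply/negP => /andP[/andP[SD /eqP Sk] /andP[SC _]].
  have : S \subset D :&: ~: D by rewrite subsetI SD SC.
  by rewrite setICr subset0 => /eqP S0; rewrite S0 cards0 in Sk; lia.
have sub : I :|: O \subset A.
  by apply/subsetP => S; rewrite !inE => /orP[]/andP[].
have cU : #|I :|: O| = 'C(#|D|, k) + 'C(#|G| - #|D|, k).
  by rewrite cardsU IO cards0 subn0 cI cO.
rewrite -cU -cA -(setIidPr sub) -cardsD; congr #|pred_of_set _|.
apply/setP => S; rewrite !inE.
have -> : (S :&: D != set0) = ~~ (S \subset ~: D).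
  by rewrite -disjoints_subset setI_eq0.
by case: (#|S| == k); rewrite ?andbF ?andbT //= negb_or andbC.
Qed.

Lemma SW_rooted k : 0 < k ->
  SW G k = \sum_(v | v != r) edge_splits #|G| k #|desc v|.
Proof.
move=> k0; rewrite /SW.
rewrite (eq_bigr (fun S => \sum_(v | v \in separating S) 1)); last first.
  move=> S /eqP Sk; rewrite sum1_card steiner_distE //.
  by apply: contraTneq k0 => S0; rewrite -Sk S0 cards0.
rewrite (exchange_big_dep [pred v | v != r]) /=; last first.
  by move=> S v _; rewrite inE => /andP[].
apply: eq_bigr => v vr; rewrite sum1_card -card_split_sets //.
by apply: eq_card => S; rewrite unfold_in !inE vr.
Qed.

End Steiner.

(** * Counting segments *)

(** A formulation of adjacency in a list that is visibly stable under reversal. *)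
Lemma mem_zip_behead (T : eqType) (s : seq T) (a b : T) :
  (a, b) \in zip s (behead s) <-> exists s1 s2, s = s1 ++ [:: a, b & s2].
Proof.
split=> [|[s1 [s2 ->]]].
  case: s => //= x s; elim: s x => //= y s IH x; rewrite inE.
  case/orP=> [/eqP[-> ->]|/IH [s1 [s2 ->]]]; first by exists [::], s.
  by exists (x :: s1), s2.
elim: s1 => [|x s1 IH] /=; first by rewrite inE eqxx.
by case: s1 IH => [|y s1] /=; rewrite !inE => ->; rewrite !orbT.
Qed.

Lemma path_graph_rev (G : sgraph) (s : seq G) : path_graph (rev s) = path_graph s.
Proof.
have sub (s' : seq G) : (path_graph (rev s')).2 \subset (path_graph s').2.
  apply/subsetP => E /imsetP[[a b] /mem_zip_behead[s1 [s2 sE]] ->] /=.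
  apply/imsetP; exists (b, a); last by rewrite /= setUC.
  apply/mem_zip_behead; exists (rev s2), (rev s1).
  by rewrite -[s']revK sE rev_cat !rev_cons -!cats1 -!catA.
rewrite /path_graph; congr pair.
  by apply/setP => x; rewrite !inE mem_rev.
apply/eqP; rewrite eqEsubset (sub s) /=.
by have := sub (rev s); rewrite revK.
Qed.

(** With a leaf as the root, a segment never turns: its highest vertex, if it were
inner, would have degree 2 and two children, hence no parent, while the root has
degree 1. So segments are climbs from their lower ends. *)
Section Segments.

Variables (G : sgraph) (r : G) (up : G -> G) (rk : G -> nat).
Hypothesis Grooted : rooted r up rk.
Hypothesis root_leaf : leaf r.

Let rk_up x : x != r -> rk (up x) < rk x.
Proof. by case: Grooted => _ + _; apply. Qed.
Let edgeE x y :
  edge x y = ((x != r) && (y == up x)) || ((y != r) && (x == up y)).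
Proof. by case: Grooted. Qed.

Let up_step (x y : G) := (x != r) && (y == up x).

Lemma degree2_nonroot (x : G) : degree x == 2 -> x != r.
Proof. by apply: contraTneq => ->; rewrite (eqP root_leaf). Qed.

Lemma segment_endE (x : G) : leaf x || branch x = (degree x != 2).
Proof.
have : 0 < degree x.
  have [->|xr] := eqVneq x r; first by rewrite (eqP root_leaf).
  by rewrite (degreeE Grooted) xr.
by rewrite /leaf /branch; lia.
Qed.

(** After a step down, a step up would return to the vertex just left. *)
Lemma down_path x y p : up_step y x -> path (@edge G) y p -> uniq [:: x, y & p] ->
  path (fun a b => up_step b a) x (y :: p).
Proof.
elim: p x y => [|z p IH] x y yx /=; first by rewrite yx.
rewrite edgeE => /andP[yz pp] /andP[xN uN]; rewrite yx /=; apply: IH => //.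
case/orP: yz => [/andP[_ /eqP zE]|//].
by move: yx xN; rewrite /up_step -zE => /andP[_ /eqP ->]; rewrite !inE eqxx orbT.
Qed.

(** After a step up into a vertex of degree 2, a step down would return to the only
child. *)
Lemma up_path x y p : up_step x y -> path (@edge G) y p -> uniq [:: x, y & p] ->
  all (fun y : G => degree y == 2) (belast y p) -> path up_step x (y :: p).
Proof.
elim: p x y => [|z p IH] x y xy /=; first by rewrite xy.
rewrite edgeE => /andP[yz pp] /andP[xN uN] /andP[dy dp]; rewrite xy /=.
apply: IH => //; case/orP: yz => // /andP[zr yz].
have xc : x \in children r up y by case/andP: xy => xr /eqP->; rewrite inE xr eqxx.
have zc : z \in children r up y by rewrite inE zr (eqP yz) eqxx.
move: dy (degree2_nonroot dy); rewrite (degreeE Grooted) => /eqP + yr.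
rewrite yr => -[] /eqP/cards1P[t cE]; move: xc zc xN.
by rewrite cE !inE => /eqP-> /eqP->; rewrite eqxx orbT.
Qed.

Fact climb_exists x : exists l, degree (iter l.+1 up x) != 2.
Proof.
suff [l lr] : exists l, iter l.+1 up x = r.
  by exists l; rewrite lr (eqP root_leaf).
elim/(rooted_ind Grooted): x => [|x xr [l IH]].
  by exists 0; case: Grooted.
by exists l.+1; rewrite iterSr.
Qed.

(** The vertices met from [x] upwards until the first one, other than [x], of
degree different from 2. *)
Definition climb x : seq G := traject up x (ex_minn (climb_exists x)).+2.

Definition segment_bottoms : {set G} := [set x | (x != r) && (degree x != 2)].

Lemma climb_segment x : x \in segment_bottoms -> segment_seq (climb x).
Proof.
rewrite inE => /andP[xr dx]; rewrite /climb; case: ex_minnP => l dl minl.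
have d2 i : 0 < i <= l -> degree (iter i up x) == 2.
  case: i => // i /= il; apply: contraT => /minl; lia.
have nr i : i <= l -> iter i up x != r.
  by case: i => // i il; apply: degree2_nonroot; apply: d2.
have rkd i j : i < j -> j <= l.+1 -> rk (iter j up x) < rk (iter i up x).
  elim: j => // j IH; rewrite ltnS leq_eqVlt => /predU1P[->|ij] jl.
    by apply: rk_up; apply: nr; lia.
  by apply: leq_trans (IH ij _); [apply: leqW; apply: rk_up; apply: nr; lia | lia].
have u : uniq (traject up x l.+2).
  apply/(uniqP x) => i j; rewrite !inE size_traject => il jl.
  rewrite !nth_traject // => E; case: (ltngtP i j) => // ij.
    by have := rkd i j ij jl; rewrite E ltnn.
  by have := rkd j i ij il; rewrite E ltnn.
have lE : last x (traject up (up x) l.+1) = iter l.+1 up x.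
  by rewrite (last_traject up x l.+1).
have bE : behead (belast x (traject up (up x) l.+1)) = traject up (up x) l.
  by rewrite trajectSr belast_rcons.
rewrite /segment_seq [traject _ _ _]/= -[_ :: traject _ _ _]/(traject up (up x) l.+1).
apply/and5P; split=> //.
- apply/(pathP x) => i; rewrite size_traject => il.
  rewrite -[x :: _]/(traject up x l.+2) nth_traject; last by lia.
  rewrite (set_nth_default (up x)) ?size_traject // nth_traject //.
  by rewrite -iterSr iterS edgeE nr ?eqxx //; lia.
- rewrite bE; apply/allP => y /trajectP[i il ->].
  by rewrite -iterSr; apply: d2; lia.
- by rewrite lE !segment_endE dx.
Qed.

Lemma up_path_climb x m z : path up_step x (rcons m z) ->
  all (fun y : G => degree y == 2) m -> degree z != 2 -> x :: rcons m z = climb x.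
Proof.
move=> pU dm dz.
have /fpathP[l mE] : fpath up x (rcons m z).
  by apply: sub_path pU => a b /andP[_ /eqP->] /=.
rewrite /climb; case: ex_minnP => k dk mink.
have lE : l = (size m).+1 by rewrite -(size_rcons m z) mE size_traject.
have m_iter i : i <= size m -> nth z (rcons m z) i = iter i.+1 up x.
  move=> im; rewrite mE (set_nth_default (up x)) ?size_traject; last by lia.
    by rewrite nth_traject ?iterSr //; lia.
have kl : k.+1 = l.
  rewrite lE; congr _.+1; apply/eqP; rewrite eqn_leq; apply/andP; split.
    by apply: mink; rewrite -m_iter // nth_rcons ltnn eqxx.
  rewrite leqNgt; apply/negP => km; move: dk; rewrite -m_iter; last exact: ltnW.
  by rewrite nth_rcons km (allP dm) // mem_nth.
by rewrite kl mE.
Qed.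

Lemma segment_climb s : segment_seq s ->
  exists2 x, x \in segment_bottoms & path_graph s = path_graph (climb x).
Proof.
case: s => // x p /and5P[]; case/lastP: p => // m z _ pp us dm.
rewrite !segment_endE last_rcons => /andP[dx dz].
have mE : behead (belast x (rcons m z)) = m.
  by rewrite belast_rcons.
rewrite {}mE in dm.
have [y [p E]] : exists y p, rcons m z = y :: p.
  by case: (m) => [|y m']; [exists z, [::] | exists y, (rcons m' z)].
have [exy py] : edge x y /\ path (@edge G) y p by move: pp; rewrite E /= => /andP.
move: exy; rewrite edgeE => /orP[] step.
  have pU : path up_step x (rcons m z).
    rewrite E in us *; apply: up_path => //.
    have : all (fun y : G => degree y == 2) (belast y p) = all (fun y : G => degree y == 2) m.
      by have := congr1 (belast x) E; rewrite belast_rcons /= => -[->].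
    by move=> ->.
  exists x; last by rewrite (up_path_climb pU).
  rewrite inE dx andbT; case: (m) pU => [|y' m'] /=; first by case/andP=> /andP[].
  by case/andP=> /andP[].
have pD : path (fun a b => up_step b a) x (rcons m z).
  by rewrite E in us *; apply: down_path.
have rE : rev (x :: rcons m z) = z :: rcons (rev m) x.
  by rewrite rev_cons rev_rcons.
have pU : path up_step z (rcons (rev m) x).
  by have := rev_sorted up_step (x :: rcons m z); rewrite rE /= pD.
exists z; last by rewrite -path_graph_rev rE (up_path_climb pU) // all_rev.
rewrite inE dz andbT; case: (rev m) pU => [|y' m'] /=; first by case/andP=> /andP[].
by case/andP=> /andP[].
Qed.

Lemma climb_inj x y : path_graph (climb x) = path_graph (climb y) -> x = y.
Proof.
have mem_climb a : a \in climb a by rewrite /climb inE eqxx.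
have climb_desc a b : b \in climb a -> a \in desc up b.
  by case/trajectP=> i _ ->; rewrite inE fconnect_iter.
case=> /setP E _; have := E x; have := E y; rewrite !in_set !mem_climb => yx xy.
by apply: (desc_anti Grooted); apply: climb_desc; rewrite ?yx // -xy.
Qed.

Lemma card_segments : #|segments G| = #|segment_bottoms|.
Proof.
rewrite -(card_in_imset (f := fun x => path_graph (climb x))); last first.
  by move=> x y _ _; apply: climb_inj.
congr #|pred_of_set _|; apply/setP => H; apply/imsetP/imsetP.
  case=> s; rewrite inE => sseg ->.
  by have [x xb ->] := segment_climb sseg; exists x.
case=> x /climb_segment seg ->.
have sz : size (climb x) <= #|G|.
  have /card_uniqP<- : uniq (climb x) by move: seg; rewrite /climb /= => /and4P[].
  exact: max_card.
by exists (Bseq sz); rewrite ?inE.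
Qed.

(** The vertices that are neither [r] nor of degree 2 are the lower ends of
segments. *)
Lemma segments_degree2 : (#|segments G| + #|[set x : G | degree x == 2]|).+1 = #|G|.
Proof.
rewrite card_segments -cardsT -(setID [set: G] [set r]) cardsU.
have -> : [set: G] :&: [set r] :&: ([set: G] :\: [set r]) = set0.
  by apply/setP => x; rewrite !inE; case: (x == r).
rewrite cards0 subn0 setTI cards1 add1n; congr _.+1.
rewrite -cardsUI [X in _ + #|pred_of_set X|](_ : _ = set0) ?cards0 ?addn0.
  congr #|pred_of_set _|; apply/setP => x; rewrite !inE andbT.
  case: (boolP (degree x == 2)) => [/degree2_nonroot->|]; first by rewrite orbT.
  by rewrite andbT orbF.
by apply/setP => x; rewrite !inE; case: (degree x == 2); rewrite !(andbF, andbT).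
Qed.

End Segments.

(** * From a rooted tree to a spine *)

Section GraphForest.

Variables (G : sgraph) (r : G) (up : G -> G) (rk : G -> nat).
Hypothesis Grooted : rooted r up rk.

Local Notation desc := (desc up).
Local Notation children := (children r up).

(** The forest of the subtrees rooted at the vertices of [s]. The fuel bounds the
height; [forest_ofP] asks for enough of it. *)
Fixpoint forest_of (fuel : nat) (s : seq G) : forest :=
  if fuel is fuel'.+1 then
    foldr (fun c f => Fcons (forest_of fuel' (enum (children c))) f) Fnil s
  else Fnil.

Lemma forest_ofP (F : nat -> nat) (b fuel : nat) (s : seq G) :
    (forall x, rk x <= b) -> (forall c, c \in s -> b < rk c + fuel) ->
  [/\ is_single (forest_of fuel s) = (size s == 1),
      fsize (forest_of fuel s) = \sum_(c <- s) #|desc c|,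
      fsum F (forest_of fuel s) = \sum_(c <- s) \sum_(x in desc c) F #|desc x|
    & funary (forest_of fuel s)
      = \sum_(c <- s) \sum_(x in desc c) (#|children x| == 1)].
Proof.
move=> rkb; elim: fuel s => [|fuel IHf] s.
  case: s => [|c s] sb; first by rewrite !big_nil.
  by have := sb c (mem_head _ _); have := rkb c; lia.
elim: s => [|c s IHs] sb; first by rewrite !big_nil.
have [|_ size_s sum_s una_s] := IHs.
  by move=> d ds; apply: sb; rewrite inE ds orbT.
have below d : d \in enum (children c) -> b < rk d + fuel.
  rewrite mem_enum inE => /andP[dr /eqP dc]; have := sb c (mem_head _ _).
  by have := (let: And3 _ H _ := Grooted in H) d dr; rewrite dc; lia.
have [sing_c size_c sum_c una_c] := IHf _ below.
rewrite [forest_of _ _]/= -/(forest_of fuel.+1 s).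
have dE (val : G -> nat) : \sum_(x in desc c) val x
    = val c + \sum_(d <- enum (children c)) \sum_(x in desc d) val x.
  by rewrite (desc_sum Grooted) big_enum.
have szE : (fsize (forest_of fuel (enum (children c)))).+1 = #|desc c|.
  rewrite size_c -sum1_card dE add1n; congr _.+1.
  by apply: eq_bigr => d _; rewrite sum1_card.
split.
- by case: (s).
- by rewrite /= szE size_s big_cons.
- by rewrite /= szE sum_c sum_s big_cons dE.
- by rewrite /= una_c una_s big_cons dE sing_c -cardE.
Qed.

Lemma sum_nonroot (val : G -> nat) : \sum_(x | x != r) val x
  = \sum_(c in children r) \sum_(x in desc c) val x.
Proof.
apply: (@addnI (val r)); rewrite -(desc_sum Grooted).
rewrite [RHS](bigD1 r) ?desc_refl //=; congr (_ + _).
by apply: eq_bigl => x; rewrite (desc_root Grooted).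
Qed.

(** The right end of the spine is the root, its left end the leaf reached through
first children. *)
Lemma graph_spine : leaf r -> exists s,
  [/\ ssize s + 2 = #|G|, sunary s = #|[set x : G | degree x == 2]|
    & forall F, spine_sum F 1 s = \sum_(x | x != r) F #|desc x|].
Proof.
move=> /eqP dr; pose b := \max_(x : G) rk x.
have rkb x : rk x <= b by apply: leq_bigmax.
have [c cE] : exists c, children r = [set c].
  by apply/cards1P; move: dr; rewrite (degreeE Grooted) eqxx add0n => ->.
have eE : enum (children r) = [:: c] by rewrite cE enum_set1.
have below d : d \in [:: c] -> b < rk d + b.+1 by lia.
have fP F := forest_ofP F rkb below.
have sum1 (val : G -> nat) :
    \sum_(x <- [:: c]) \sum_(x in desc c) val x = \sum_(x | x != r) val x.
  by rewrite sum_nonroot cE big_set1 big_seq1.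
set f := forest_of b (enum (children c)).
have feq : forest_of b.+1 [:: c] = Fcons f Fnil by [].
exists (descend f); split.
- rewrite ssize_descend; have [_ sz _ _] := fP id.
  move: sz; rewrite feq big_seq1 /= addn0 -sum1_card.
  have := sum1 (fun => 1); rewrite big_seq1 => ->.
  rewrite sum1_card (@eq_card _ _ (predC1 r)) // cardC1.
  have : 0 < #|G| by apply/card_gt0P; exists r.
  by move=> G0 sz; rewrite addn2 sz prednK.
- rewrite sunary_descend; have [_ _ _] := fP id.
  rewrite feq big_seq1 /= !addn0 => ->.
  have := sum1 (fun x => #|children x| == 1); rewrite big_seq1 => ->.
  rewrite -sum1_card [RHS]big_mkcond [RHS](bigD1 r) //= inE dr /= add0n.
  by apply: eq_bigr => x xr; rewrite inE (degreeE Grooted) xr /=; case: eqP => ?; case: eqP; lia.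
- move=> F; have [_ _ + _] := fP F.
  rewrite feq big_seq1 /= !addn0; have := sum1 (fun x => F #|desc x|).
  rewrite big_seq1 => -> <-; rewrite -[descend f]cats0 spine_sum_descend /=.
  by rewrite addnC.
Qed.

End GraphForest.

(** A vertex of maximal rank for any choice of the root. *)
Lemma tree_leaf (G : sgraph) : is_tree G -> 1 < #|G| -> exists r : G, leaf r.
Proof.
move=> Gt G1; have /card_gt0P[r0 _] : 0 < #|G| by apply: ltnW.
have [up [rk Gr]] := tree_rooted r0 Gt.
have [x xmax] : exists x : G, forall y, rk y <= rk x.
  by exists [arg max_(i > r0) rk i]; case: arg_maxnP => // x _ H y; apply: H.
exists x; rewrite /leaf (degreeE Gr).
have c0 : children r0 up x = set0.
  apply/setP => c; rewrite !inE; apply/negP => /andP[cr /eqP cx].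
  have [_ H _] := Gr; have := H c cr; have := xmax c; rewrite cx; lia.
rewrite c0 cards0 addn0; suff -> : x != r0 by [].
apply: contraTneq G1 => xr; rewrite -leqNgt -(cards1 r0) -cardsT.
apply/subset_leq_card/subsetP => y _; rewrite inE; apply: contraT => yr.
have [le E] := desc_rk Gr (desc_root Gr y); rewrite (negPf yr) in E.
by rewrite -E eqn_leq le -xr xmax.
Qed.

(** * The caterpillar of a word *)

Section Caterpillar.

Variable w : seq nat.

Let t := (size w).+1.

(** Letter [x] of the word stands for a spine vertex with [x.-1] pendant vertices.
The letters start at the spine vertex 1; the default 1 of [nth] leaves both ends of
the spine without pendant vertices. *)
Definition pendants (j : nat) : nat := if j is j'.+1 then (nth 1 w j').-1 else 0.

Definition cat_vertex : finType := ('I_t.+1 + {j : 'I_t.+1 & 'I_(pendants j)})%type.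

Definition cat_root : cat_vertex := inl ord0.

Definition cat_up (x : cat_vertex) : cat_vertex :=
  match x with inl i => inl (inord i.-1) | inr p => inl (tag p) end.

Definition cat_edge (x y : cat_vertex) : bool :=
  ((x != cat_root) && (y == cat_up x)) || ((y != cat_root) && (x == cat_up y)).

(** The position at which a vertex is attached to the spine, or sits on it. *)
Definition cat_index (x : cat_vertex) : nat :=
  match x with inl i => i | inr p => tag p end.

Definition cat_rank (x : cat_vertex) : nat :=
  match x with inl i => i | inr p => (tag p).+1 end.

Lemma eq_inl (i j : 'I_t.+1) : (inl i == inl j :> cat_vertex) = (i == j :> nat).
Proof. by apply/eqP/eqP => [[->]|/val_inj->]. Qed.

Lemma cat_rank_up x : x != cat_root -> cat_rank (cat_up x) < cat_rank x.
Proof.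
case: x => [i|p] //= ir; have i0 : 0 < i.
  by rewrite lt0n; rewrite eq_inl in ir.
by rewrite inordK; have := ltn_ord i; lia.
Qed.

Lemma cat_edge_sym : symmetric cat_edge.
Proof. by move=> x y; rewrite /cat_edge orbC. Qed.

Lemma cat_edge_irrefl : irreflexive cat_edge.
Proof.
move=> x; rewrite /cat_edge orbb; apply/negP => /andP[xr /eqP xE].
by have := cat_rank_up xr; rewrite -xE ltnn.
Qed.

Definition cat_graph : sgraph := SGraph cat_edge_sym cat_edge_irrefl.

Lemma cat_rooted : @rooted cat_graph cat_root cat_up cat_rank.
Proof.
split=> //; last by move=> x xr; apply: cat_rank_up.
by apply/eqP; rewrite eq_inl inordK.
Qed.

Definition cat_spine (j : nat) : cat_graph := inl (inord j).

Lemma sum_pendants_tag (val : 'I_t.+1 -> nat) :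
  \sum_(p : {j : 'I_t.+1 & 'I_(pendants j)}) val (tag p)
  = \sum_(j < t.+1) pendants j * val j.
Proof.
rewrite -(@sig_big_dep _ _ _ _ _ xpredT (fun _ => xpredT) (fun j _ => val j)) /=.
by apply: eq_bigr => j _; rewrite sum_nat_const card_ord.
Qed.

Lemma sum_cat_graph (val : cat_graph -> nat) :
  \sum_x val x = \sum_(i < t.+1) val (inl i) + \sum_p val (inr p).
Proof. exact: big_sumType. Qed.

Hypothesis w1 : all (leq 1) w.

Lemma pendantsE j : j < size w -> (pendants j.+1).+1 = nth 0 w j.
Proof.
move=> jw; rewrite /= (set_nth_default 0) // prednK //.
exact: (all_nthP 0 w1).
Qed.

Lemma pendants_out j : t <= j -> pendants j = 0.
Proof. by case: j => //= j jt; rewrite nth_default. Qed.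

Lemma cat_degree_pendant p : degree (inr p : cat_graph) = 1.
Proof.
rewrite (degreeE cat_rooted) /= (_ : children _ _ _ = set0) ?cards0 //.
by apply/setP => -[i|q]; rewrite !inE //= andbF.
Qed.

Lemma cat_degree_spine (i : 'I_t.+1) :
  degree (inl i : cat_graph) = (0 < i) + (i < t) + pendants i.
Proof.
rewrite (degreeE cat_rooted) -addnA eq_inl -lt0n; congr (_ + _).
rewrite -sum1_card big_mkcond sum_cat_graph; congr (_ + _).
  transitivity (\sum_(j < t.+1) (j == i.+1 :> nat)).
    apply: eq_bigr => j _; rewrite inE !eq_inl inordK; last by have := ltn_ord j; lia.
    by case: (nat_of_ord j) => [|j'] //=; rewrite eqSS; case: eqP.
  have [it|it] := ltnP i t.
    rewrite (bigD1 (Ordinal (it : i.+1 < t.+1))) //= eqxx big1 // => j.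
    by rewrite -val_eqE /= => /negPf->.
  by rewrite big1 // => j _; have := ltn_ord j; case: eqP; lia.
transitivity (\sum_(p : {j : 'I_t.+1 & 'I_(pendants j)}) (tag p == i)).
  by apply: eq_bigr => p _; rewrite inE eq_inl -val_eqE /=; case: eqP.
rewrite (sum_pendants_tag (fun j => j == i)) (bigD1 i) //= eqxx muln1 big1 ?addn0 // => j /negPf->.
by rewrite muln0.
Qed.

Lemma cat_degree_inner j : j < size w ->
  degree (cat_spine j.+1) = (nth 0 w j).+1.
Proof.
move=> jw; rewrite cat_degree_spine inordK; last by rewrite /t; lia.
by rewrite -pendantsE // (_ : j.+1 < t).
Qed.

Lemma cat_leaf_first : leaf (cat_spine 0).
Proof. by rewrite /leaf cat_degree_spine inordK. Qed.

Lemma cat_leaf_last : leaf (cat_spine t).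
Proof.
by rewrite /leaf cat_degree_spine inordK // ltnn pendants_out.
Qed.

Lemma cat_vertexP (x : cat_graph) :
  (exists2 p, x = inr p & 0 < tag p < t) \/ exists2 j, j <= t & x = cat_spine j.
Proof.
case: x => [i|p]; [right|left].
  by exists (i : nat); [rewrite -ltnS | apply/eqP; rewrite eq_inl inordK].
exists p => //; have : 0 < pendants (tag p) by exact: leq_ltn_trans (ltn_ord (tagged p)).
case: (nat_of_ord (tag p)) => //= j.
by rewrite [j.+1 < t]ltnS [j < _]ltnNge; apply: contraTN => jt; rewrite nth_default.
Qed.

Lemma cat_nonleaf x : ~~ leaf x <-> exists2 j, 0 < j < t & x = cat_spine j.
Proof.
split; last first.
  case=> -[|j] // jt ->; rewrite /leaf cat_degree_inner //.
  by rewrite eqSS -lt0n (all_nthP 0 w1).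
case: (cat_vertexP x) => [[p -> _]|[j jt ->]]; first by rewrite /leaf cat_degree_pendant.
move=> nl; exists j => //; apply/andP; split.
  by rewrite lt0n; apply: contraNneq nl => ->; apply: cat_leaf_first.
by rewrite ltn_neqAle jt andbT; apply: contraNneq nl => ->; apply: cat_leaf_last.
Qed.

Lemma cat_spine_inj : {in [pred j | j <= t] &, injective cat_spine}.
Proof.
move=> i j; rewrite !inE => it jt /eqP.
by rewrite eq_inl !inordK // => /eqP.
Qed.

Lemma cat_spine_edge j : j < t -> @edge cat_graph (cat_spine j) (cat_spine j.+1).
Proof.
by move=> jt; rewrite /= /cat_edge !eq_inl !inordK ?eqxx ?orbT //; lia.
Qed.

Lemma cat_spineP : spine t cat_spine.
Proof.
split=> //; [exact: cat_spine_inj | exact: cat_spine_edge | exact: cat_nonleaf |].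
move=> x out; case: (cat_vertexP x) => [[p xp pt]|[j jt xj]]; last by case: (out j jt).
split; first by rewrite xp /leaf cat_degree_pendant.
exists (tag p) => //; rewrite xp /= /cat_edge /=; apply/orP; left.
by rewrite eq_inl inordK.
Qed.

Lemma cat_caterpillar : caterpillar cat_graph.
Proof.
split; first exact: rooted_tree cat_rooted.
exists [seq cat_spine j | j <- iota 1 (size w)]; split.
- rewrite map_inj_in_uniq ?iota_uniq // => i j; rewrite !mem_iota => iw jw.
  by apply: cat_spine_inj; rewrite inE /t; lia.
- have cat_path a l : a + l <= t ->
      path (@edge cat_graph) (cat_spine a) [seq cat_spine j | j <- iota a.+1 l].
    elim: l a => //= l IH a al; rewrite IH; last by lia.
    by rewrite andbT; apply: cat_spine_edge; lia.
  by apply: (@path_sorted _ _ (cat_spine 0)); apply: cat_path; rewrite /t.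
- move=> x; apply/mapP/idP => [[j]|/cat_nonleaf[j jt ->]].
    by rewrite mem_iota => jw ->; apply/cat_nonleaf; exists j; rewrite // /t; lia.
  by exists j => //; rewrite mem_iota; move: jt; rewrite /t; lia.
Qed.

Lemma sum_pendants a b : 0 < a -> a + b <= t ->
  \sum_(a <= i < a + b) (pendants i).+1 = sumn (take b (drop a.-1 w)).
Proof.
case: a => // a _; rewrite /t addSn ltnS /= => ab; elim: b ab => [|b IH] ab.
  by rewrite big_geq ?take0 //; lia.
rewrite addnS big_nat_recr; last by lia.
rewrite IH; last by lia.
rewrite (take_nth 0) ?size_drop; last by lia.
by rewrite sumn_rcons nth_drop -pendantsE; [|lia].
Qed.

Lemma cat_card : #|cat_graph| = sumn w + 2.
Proof.
have H : \sum_(p : {j : 'I_t.+1 & 'I_(pendants j)}) 1 = \sum_(j < t.+1) pendants j.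
  by rewrite (sum_pendants_tag (fun => 1)); apply: eq_bigr => j _; rewrite muln1.
rewrite -sum1_card sum_cat_graph H -big_split /=.
rewrite (eq_bigr (fun i : 'I_t.+1 => (pendants i).+1)) => [|i _]; last by rewrite add1n.
rewrite -(big_mkord xpredT (fun i => (pendants i).+1)) big_nat_recr //.
rewrite pendants_out // big_ltn // (@sum_pendants 1 (size w)) // drop0 take_size /=.
lia.
Qed.

Lemma cat_degree2 : #|[set x : cat_graph | degree x == 2]| = count_mem 1 w.
Proof.
rewrite -sum1_card big_mkcond sum_cat_graph [X in _ + X]big1 => [|p _]; last first.
  by rewrite inE cat_degree_pendant.
rewrite addn0.
rewrite (eq_bigr (fun i : 'I_t.+1 => (0 < i < t) && (pendants i == 0) : nat)).
  rewrite -(big_mkord xpredT (fun i => (0 < i < t) && (pendants i == 0) : nat)).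
  rewrite big_nat_recr // ltnn andbF andFb [LHS]addn0.
  rewrite big_ltn // ltnn !andFb [LHS]add0n big_add1.
  rewrite -sum1_count [RHS]big_mkcond [RHS](big_nth 0).
  apply: eq_big_nat => i /= iw; rewrite ltnS iw /=.
  by have := pendantsE iw; rewrite /= => <-; case: (_.-1).
move=> i _; rewrite inE cat_degree_spine.
have [->//|i0] := posnP i; case: ltnP => it; last by rewrite pendants_out.
by case: (pendants i).
Qed.

Lemma cat_desc (x : cat_graph) (i : 'I_t.+1) :
  (x \in desc (G := cat_graph) cat_up (inl i)) = (i <= cat_index x).
Proof.
elim/(rooted_ind cat_rooted): x => [|x xr IH]; rewrite (descE cat_rooted).
  by rewrite eqxx orbF eq_inl /= leqn0 eq_sym.
rewrite xr IH; case: x xr {IH} => [j|p] //=; rewrite !eq_inl => j0.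
by rewrite inordK; have := ltn_ord j; lia.
Qed.

Lemma cat_desc_pendant p : desc (G := cat_graph) cat_up (inr p) = [set inr p].
Proof.
apply/setP => x; rewrite in_set1; elim/(rooted_ind cat_rooted): x => [|x xr IH].
  by rewrite (descE cat_rooted) eqxx orbF.
by rewrite (descE cat_rooted) xr IH; case: x {xr IH} => [i|q]; rewrite orbF.
Qed.

(** Everything attached at or after position [i] is below it; the extra 1 is the
last spine vertex. *)
Lemma cat_card_desc (i : 'I_t.+1) : 0 < i ->
  #|desc (G := cat_graph) cat_up (inl i)| = (sumn (drop i.-1 w)).+1.
Proof.
move=> i0; rewrite -sum1_card big_mkcond sum_cat_graph.
rewrite (eq_bigr (fun j : 'I_t.+1 => (i <= j) : nat)) => [|j _]; last first.
  by rewrite cat_desc /=; case: leqP.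
rewrite [X in _ + X](eq_bigr
  (fun p : {j : 'I_t.+1 & 'I_(pendants j)} => (i <= tag p) : nat)) => [|p _];
  last by rewrite cat_desc /=; case: leqP.
rewrite (sum_pendants_tag (fun j => i <= j)) -big_split /=.
rewrite (eq_bigr (fun j : 'I_t.+1 => if i <= j then (pendants j).+1 else 0)); last first.
  by move=> j _; case: leqP; rewrite ?muln1 ?muln0 ?add1n.
rewrite -big_mkcond /= -(big_mkord (fun j => i <= j) (fun j => (pendants j).+1)).
rewrite (big_cat_nat (n := i)) //=; last by rewrite ltnW.
rewrite big1_seq ?add0n => [|j]; last by rewrite mem_index_iota; lia.
rewrite big_nat_cond (eq_bigl (fun j => (i <= j < t.+1) && true)) -?big_nat_cond; last first.
  by move=> j; case: (leqP i j); rewrite ?andbF ?andbT.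
have it := ltn_ord i; rewrite big_nat_recr // pendants_out // [LHS]addn1; congr _.+1.
rewrite -{2}(subnKC (_ : i <= t)) // sum_pendants //; last by rewrite subnKC.
by rewrite take_oversize // size_drop /t; lia.
Qed.

Section EdgeFunction.

Variable F : nat -> nat.
Hypothesis F_sym : forall a, a <= sumn w + 2 -> F (sumn w + 2 - a) = F a.

Lemma word_sumE a v : word_sum F a v =
  \sum_(j < (size v).+1) F (a + sumn (take j v)) + \sum_(x <- v) x.-1 * F 1.
Proof.
elim: v a => [|x v IH] a; first by rewrite big_ord1 big_nil /= !addn0.
rewrite big_ord_recl big_cons /= IH addn0.
rewrite (eq_bigr (fun j : 'I__ => F (a + x + sumn (take j v)))) => [|j _].
  by rewrite /= addnACA.
by rewrite addnA.
Qed.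

(** The descendants of spine vertex [j] lie on the right of the edge above it;
symmetry of [F] turns them into the vertices on the left, which [word_sum]
reads. *)
Lemma cat_edge_sum : \sum_(x | x != cat_root) F #|desc (G := cat_graph) cat_up x|
  = word_sum F 1 w.
Proof.
rewrite big_mkcond sum_cat_graph big_ord_recl eqxx add0n word_sumE; congr (_ + _).
  apply: eq_bigr => j _; rewrite cat_card_desc //.
  have sw : sumn (take j w) + sumn (drop j w) = sumn w.
    by rewrite -sumn_cat cat_take_drop.
  by rewrite lift0 /= -F_sym; [congr F | ]; move: sw; rewrite -/t; lia.
rewrite (eq_bigr (fun p : {j : 'I_t.+1 & 'I_(pendants j)} => F 1)) => [|p _]; last first.
  by rewrite cat_desc_pendant cards1.
rewrite (sum_pendants_tag (fun => F 1)).
rewrite -(big_mkord xpredT (fun j => pendants j * F 1)).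
rewrite big_nat_recr // pendants_out // [LHS]addn0 big_ltn // [LHS]add0n big_add1.
by rewrite [RHS](big_nth 1).
Qed.

End EdgeFunction.

End Caterpillar.

(** * The extremal caterpillars *)

Lemma tree_spine (U : sgraph) (n m : nat) : 1 < n -> tree_with U n m ->
  exists s, [/\ ssize s + 2 = n, m + sunary s + 1 = n
    & forall k, 0 < k -> SW U k = spine_sum (edge_splits n k) 1 s].
Proof.
move=> n1 [Ut Un Um]; have [|r rl] := tree_leaf Ut; first by rewrite Un.
have [up [rk Ur]] := tree_rooted r Ut.
have [s [ss us sums]] := graph_spine Ur rl.
exists s; split; first by rewrite ss.
  by rewrite us -Um addn1 (segments_degree2 Ur rl).
by move=> k k0; rewrite (SW_rooted Ur) // Un sums.
Qed.

Lemma cat_tree_with (w : seq nat) : all (leq 1) w ->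
  tree_with (cat_graph w) (sumn w + 2) (sumn w + 1 - count_mem 1 w).
Proof.
move=> w1; split; [exact: rooted_tree (cat_rooted w) | exact: cat_card |].
have rl : @leaf (cat_graph w) (cat_root w).
  have -> : cat_root w = cat_spine w 0 by apply/eqP; rewrite eq_inl inordK.
  exact: cat_leaf_first.
have := segments_degree2 (cat_rooted w) rl.
by rewrite cat_degree2 // cat_card //; lia.
Qed.

Lemma cat_SW (w : seq nat) (k : nat) : all (leq 1) w -> 0 < k ->
  SW (cat_graph w) k = word_sum (edge_splits (sumn w + 2) k) 1 w.
Proof.
move=> w1 k0; rewrite (SW_rooted (cat_rooted w)) // cat_card //.
by rewrite cat_edge_sum // => a; apply: edge_splits_sym.
Qed.

Lemma cat_shape (w : seq nat) (D4 D3 : pred nat) : all (leq 1) w ->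
    (forall j, D4 j -> 0 < j <= size w /\ nth 0 w j.-1 = 3) ->
    (forall j, D3 j -> 0 < j <= size w /\ nth 0 w j.-1 = 2) ->
    (forall j, 0 < j <= size w -> ~~ D4 j -> ~~ D3 j -> nth 0 w j.-1 = 1) ->
  caterpillar_shape (cat_graph w) (sumn w + 2) (sumn w + 1 - count_mem 1 w)
    (size w).+1 D4 D3.
Proof.
move=> w1 H4 H3 H2; split; [exact: cat_caterpillar | exact: cat_tree_with |].
exists (cat_spine w); first exact: cat_spineP.
have deg j : 0 < j <= size w -> degree (cat_spine w j) = (nth 0 w j.-1).+1.
  by case: j => // j jw; rewrite cat_degree_inner.
split=> [j /H4[jw E]|j /H3[jw E]|j jw j4 j3]; rewrite deg ?E //.
by rewrite H2.
Qed.

Lemma split_word_shape_even p q z w : odd p = false -> w = split_word p q z ->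
  caterpillar_shape (cat_graph w) (sumn w + 2) (sumn w + 1 - count_mem 1 w)
    (size w).+1 (fun j => false)
    (fun j => (1 <= j <= p./2)
           || ((size w).+1 <= j + q./2) && (j + 1 <= (size w).+1)).
Proof.
move=> op wE; have p3 : odd p -> 2 < p by rewrite op.
have sw : size w = p./2 + z + q./2 by rewrite wE; apply: size_split_word.
have nthw j : 0 < j <= size w -> nth 0 w j.-1 =
    if j.-1 < p./2 then 2 else if j.-1 < p./2 + z then 1 else 2.
  by move=> jw; rewrite wE nth_split_word ?op //; lia.
move: (p./2) (q./2) sw nthw => l r sw nthw {p3 op}.
apply: cat_shape => [|//|j d3|j jw _ d3]; first by rewrite wE all_split_word.
  by split; [lia | rewrite nthw; [case: ltnP; case: ltnP => // | ]; lia].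
by rewrite nthw //; case: ltnP; case: ltnP => //; lia.
Qed.

(** It serves the two even residues of [m] modulo 4, which differ only in the
sizes of the two ends. *)
Lemma split_word_shape_odd p q z w : odd p -> 2 < p -> w = split_word p q z ->
  caterpillar_shape (cat_graph w) (sumn w + 2) (sumn w + 1 - count_mem 1 w)
    (size w).+1 (fun j => j == 1)
    (fun j => (2 <= j <= p./2)
           || ((size w).+1 <= j + q./2) && (j + 1 <= (size w).+1)).
Proof.
move=> op p2 wE; have p3 : odd p -> 2 < p by [].
have sw : size w = p./2 + z + q./2 by rewrite wE; apply: size_split_word.
have nthw j : 0 < j <= size w -> nth 0 w j.-1 =
    if j.-1 < p./2 then (if j.-1 == 0 then 3 else 2)
    else if j.-1 < p./2 + z then 1 else 2.
  by move=> jw; rewrite wE nth_split_word ?op //; lia.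
have l0 : 0 < p./2 by lia.
move: (p./2) (q./2) l0 sw nthw => l r l0 sw nthw {p3 op p2}.
apply: cat_shape => [|j /eqP->|j d3|j jw /eqP j1 d3]; first by rewrite wE all_split_word.
- by split; [lia | rewrite nthw //= ?l0 //; lia].
- split; first by lia.
  rewrite nthw; last by lia.
  case: eqP => [j1|_]; last by case: ltnP; case: ltnP => //; lia.
  by exfalso; lia.
rewrite nthw // (_ : (j.-1 == 0) = false); last by lia.
by case: ltnP; case: ltnP => //; lia.
Qed.

(** For even [m], the share 1 on the left would be chosen for [m] = 2 or 4, and
cannot be realized by a word. *)
Lemma balanced_shares m : 0 < m -> m <> 2 -> m <> 4 -> exists p q,
  [/\ p + q = m.-1, ~~ odd q, odd p -> 2 < p, p <= q.+2 <= p.+4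
    & if odd p then
        [/\ 4 %| m, m %/ 4 - 1 = p./2 & m %/ 4 = q./2] \/
        [/\ m = 2 %[mod 4], (m - 4) %/ 4 + 1 = p./2 & ceil_div (m - 4) 4 = q./2]
      else (m - 1) %/ 4 = p./2 /\ ceil_div (m - 1) 4 = q./2].
Proof.
case: m => // m _; rewrite (divn_eq m 4) mulnC.
move: (m %/ 4) (m %% 4) (ltn_pmod m (isT : 0 < 4)) => {m} a.
have E b : 4 * a + b = (a.*2).*2 + b by rewrite -!muln2 -mulnA mulnC.
have half_a : a.*2./2 = a := doubleK a.
have half_a1 : a.*2.+1./2 = a := uphalf_double a.
have div4 b : b < 4 -> (4 * a + b) %/ 4 = a.
  by move=> b4; rewrite mulnC divnMDl // divn_small ?addn0.
have div4' : (4 * a.+1) %/ 4 = a.+1 by rewrite mulKn.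
have a2 : a.*2 = 2 * a by rewrite mul2n.
case=> [|[|[|[|]]]] // _ m2 m4.
- exists a.*2, a.*2; rewrite odd_double; split=> //; first by lia.
    by apply/andP; split; lia.
  rewrite /ceil_div half_a subn1 /= addn0 -{1}[4 * a]addn0.
  by rewrite !div4.
- have a0 : 0 < a by lia.
  exists a.*2.+1, a.*2; rewrite /= odd_double; split=> //; [lia|lia| |].
    by apply/andP; split; lia.
  right; rewrite -[uphalf _]/(a.*2.+1./2) half_a half_a1 /ceil_div.
  have -> : (4 * a + 1).+1 - 4 = 4 * a.-1 + 2 by lia.
  have -> : 4 * a.-1 + 2 + 3 = 4 * a + 1 by lia.
  split; last by rewrite div4.
    by rewrite -addnS mulnC modnMDl.
  by rewrite (mulnC 4 a.-1) divnMDl // divn_small // addn0 addn1 prednK.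
- exists a.*2, a.*2.+2; rewrite /= !negbK odd_double; split=> //; first by lia.
    by apply/andP; split; lia.
  rewrite half_a subn1 /= /ceil_div div4 //.
  split=> //; have -> : 4 * a + 2 + 3 = a.+1 * 4 + 1 by lia.
  by rewrite divnMDl // divn_small // addn0.
- have a0 : 0 < a by lia.
  exists a.*2.+1, a.*2.+2; rewrite /= !negbK odd_double; split=> //; [lia|lia| |].
    by apply/andP; split; lia.
  left; have -> : (4 * a + 3).+1 = 4 * a.+1 by lia.
  by rewrite div4' dvdn_mulr // half_a subn1.
Qed.

Theorem theorem5p2 (k n m : nat) (k_gt0 : 0 < k)
    (* for n = 1 (no segment) and for m = 4, none of the four trees exists *)
    (n_gt1 : 1 < n) (m_neq4 : m <> 4)
    (exists_tree : exists U : sgraph, tree_with U n m) :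
  exists T : sgraph,
    [/\ T_i n m T \/ T_ii n m T \/ T_iii n m T \/ T_iv n m T,
        tree_with T n m
      & forall U : sgraph, tree_with U n m -> SW U k <= SW T k].
Proof.
have [U0 /(tree_spine n_gt1)[s0 [ss0 us0 _]]] := exists_tree.
have [M ME M1] := sunary_total s0.
have [||//|p [q [pq oq p3 /andP[le1 le2] shares]]] := @balanced_shares m; [lia..|].
pose z := n - m - 1; pose w := split_word p q z.
have w1 : all (leq 1) w := all_split_word p q z.
have sw : sumn w + 2 = n by rewrite sumn_split_word // /z; lia.
have mE : sumn w + 1 - count_mem 1 w = m by rewrite count1_split_word /z; lia.
exists (cat_graph w); split; last 2 first.
- by have := cat_tree_with w1; rewrite sw mE.
- move=> U /(tree_spine n_gt1)[s [ss us ->]] //; rewrite cat_SW // sw.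
  rewrite /w (_ : z = sunary s); last by rewrite /z; lia.
  apply: (@spine_bound n) => //; last by lia.
  + exact: edge_splits_sym.
  + by move=> a; apply: edge_splits_mono.
  + by move=> a; apply: edge_splits_conc.
(* [c] is 1 exactly when the word starts with a letter 3. *)
have tE c : c = odd p -> 2 * (size w).+1 + m + (1 + c) = 2 * n.
  move=> ->; rewrite size_split_word //.
  have := odd_double_half p; have := odd_double_half q.
  rewrite (negPf oq) /z -!muln2; move: p./2 q./2 (odd p) => p2 q2 [] /=; lia.
right; move: shares; case: ifP => op.
  have := split_word_shape_odd op (p3 op) (erefl w); rewrite sw mE => shape.
  case=> [[m4 pE qE]|[m2 pE qE]]; right; [left | right]; split=> //.
    by exists (size w).+1; [exact: (tE true) | rewrite pE qE].
  by exists (size w).+1; [exact: (tE true) | rewrite pE qE].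
have := split_word_shape_even op (erefl w); rewrite sw mE => shape.
case=> pE qE; left; exists (size w).+1; first exact: (tE false).
by rewrite pE qE.
Qed.
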